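(* Let $S=\begin{pmatrix}1&0\\0&-1\end{pmatrix}$, $T=\begin{pmatrix}0&1\\1&0\end{pmatrix}$, $c=\frac{19}{10}$ and $X_0=e^{3S}=\begin{pmatrix}e^{3}&0\\0&e^{-3}\end{pmatrix}$. Put $Z_1=3S$, $Z_2=cT$, $Z_3=-Z_1-Z_2$, and for $i=1,2,3$ let $B_i=e^{Z_i}$ and $A_i=B_iX_0B_i$. Then the equation $$\Phi(X):=\frac13\sum_{i=1}^{3}\log\bigl(A_i\,\sharp\, X^{-1}\bigr)=0$$ has at least two distinct solutions $X\in\mathbb{P}_2$.
   Context: $\mathbb{P}_n$ denotes the set of $n\times n$ (complex Hermitian) positive definite matrices. For $A,B\in\mathbb{P}_n$, the geometric mean is $A\sharp B=A^{1/2}(A^{-1/2}BA^{-1/2})^{1/2}A^{1/2}$. $\log$ is the principal (Hermitian) logarithm of a positive definite matrix. *)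

(* Defs.v *)
From HB Require Import structures.
From mathcomp Require Import all_boot all_order all_algebra spectral.
From mathcomp Require Import all_classical all_reals all_analysis.
From mathcomp Require Import complex.

Set Implicit Arguments.
Unset Strict Implicit.
Unset Printing Implicit Defensive.

Import Order.TTheory GRing.Theory Num.Theory.
Import numFieldNormedType.Exports.
Local Open Scope classical_set_scope.
Local Open Scope ring_scope.
Local Open Scope complex_scope.
Local Open Scope sesquilinear_scope.

Definition mx2 (K : pzRingType) (a b c d : K) : 'M[K]_2 :=
  \matrix_(i < 2, j < 2) nth 0 (nth [::] [:: [:: a; b]; [:: c; d]] i) j.

(* The order on a numClosedFieldType is partial: 0 < z forces z to be real. *)
Definition posdefmx (C : numClosedFieldType) (n : nat) (A : 'M[C]_n) : Prop :=
  A \is hermsymmx /\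
  forall v : 'cV[C]_n, v != 0 -> 0 < (v ^t* *m A *m v) 0 0.

(* Exponential power series, with the limit taken for the max norm on 'M[K]. *)
Definition mxexp (K : numFieldType) (n : nat) (A : 'M[K]_n.+1) : 'M[K]_n.+1 :=
  lim (series (fun k : nat => (k`!%:R)^-1 *: A ^+ k) @ \oo).

(* Functional calculus f(A) = P^-1 diag(f(d)) P for A = P^-1 diag(d) P with P
   unitary.  Meaningful for Hermitian A: the eigenvalues in spectral_diag A are
   then real, so complex.Re loses nothing, and the result does not depend on
   the diagonalization chosen by spectralmx. *)
Definition hermfun (R : realType) (n : nat) (f : R -> R) (A : 'M[R[i]]_n) :
    'M[R[i]]_n :=
  invmx (spectralmx A)
    *m diag_mx (map_mx (fun z => (f (complex.Re z))%:C) (spectral_diag A))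
    *m spectralmx A.

Definition mxsqrt (R : realType) (n : nat) (A : 'M[R[i]]_n) : 'M[R[i]]_n :=
  hermfun Num.sqrt A.

Definition mxlog (R : realType) (n : nat) (A : 'M[R[i]]_n) : 'M[R[i]]_n :=
  hermfun (@ln R) A.

Definition gmean (R : realType) (n : nat) (A B : 'M[R[i]]_n) : 'M[R[i]]_n :=
  mxsqrt A *m mxsqrt (invmx (mxsqrt A) *m B *m invmx (mxsqrt A)) *m mxsqrt A.

(* Main.v *)
Require Import Defs.
From HB Require Import structures.
From Stdlib Require Import ZArith.
From mathcomp Require Import all_boot all_order all_algebra spectral.
From mathcomp Require Import all_classical all_reals all_analysis.
From mathcomp Require Import complex ssrZ zify ring lra.

Set Implicit Arguments.
Unset Strict Implicit.
Unset Printing Implicit Defensive.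

Import Order.TTheory GRing.Theory Num.Theory.
Import numFieldNormedType.Exports.
Local Open Scope ring_scope.
Local Open Scope complex_scope.
Local Open Scope sesquilinear_scope.

(** Every matrix in the problem is real symmetric, and a real symmetric matrix
    of determinant one is [smx h p q], with diagonal entries [h + p], [h - p]
    and off-diagonal entry [q], where [h ^+ 2 - (p ^+ 2 + q ^+ 2) = 1].  On this
    hyperboloid the functional calculus is explicit: the geometric mean of [M]
    and [N] is [M + N] divided by the square root of the determinant of [M + N]
    ([smx_gmean]), and the logarithm of [smx h p q] is a multiple of
    [smx 0 p q] ([smx_log]).

    The first solution is [X0].  If [A = B X B] then the geometric mean of [A]
    and the inverse of [X] is [B] ([smx_gmean_conj]), so that the three
    logarithms at [X0] are [Z1], [Z2], [Z3], whose sum is zero.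

    The second solution has determinant one as well; its inverse is written
    [smx h P Q] with [h] determined by [P] and [Q].  The sum of the three
    logarithms is then [smx 0 F G] for two explicit real functions of [(P, Q)]
    ([log_gmean]), and a common zero of [F] and [G] is found in the rectangle
    with [P] in [-3, -2] and [Q] in [-1.05, -0.65].  Numerically it is near
    [P = -2.518], [Q = -0.813], while [X0] corresponds to [P = - sinh 3],
    [Q = 0].  In place of [F] and [G] the proof uses two linear combinations
    of them:
    - [crossF], the cross product of [(F, G)] with the direction of the first
      logarithm.  This eliminates the first logarithm, and what remains is
      strictly increasing in [Q] ([crossF_incr]);
    - [diffF], which is [F - G].
    On the rectangle [crossF] is negative at the bottom and positive at the
    top, and [diffF] is negative on the left and positive on the right.  By
    monotonicity the zero set of [crossF] is the graph of a continuous function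
    of [P], and the intermediate value theorem applied to [diffF] along this
    graph gives the common zero ([common_zero]).

    The four sign conditions are strict inequalities between explicit
    expressions in exponentials, logarithms and square roots; an edge is cut
    into short segments and the signs are certified by interval arithmetic on
    dyadic numbers with a fixed denominator. *)

(** * Functional calculus on real symmetric 2 x 2 matrices *)

(** The coordinates [h], [p], [q] are those in the basis formed by the
    identity, [S] and [T] of the real symmetric matrices. *)
Definition smx (R : realType) (h p q : R) : 'M[R[i]]_2 :=
  mx2 (h + p)%:C q%:C q%:C (h - p)%:C.

Lemma mx2P (K : pzRingType) (A B : 'M[K]_2) :
  A 0 0 = B 0 0 -> A 0 1 = B 0 1 -> A 1 0 = B 1 0 -> A 1 1 = B 1 1 -> A = B.
Proof.
move=> h1 h2 h3 h4; apply/matrixP => i j.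
have two (k : 'I_2) : k = 0 \/ k = 1.
  by case: k => [[|[|k]] hk] //; [left|right]; apply: val_inj.
by case: (two i) => ->; case: (two j) => ->.
Qed.

Lemma mx2_mul (K : pzRingType) (a b c d a' b' c' d' : K) :
  mx2 a b c d *m mx2 a' b' c' d' =
  mx2 (a * a' + b * c') (a * b' + b * d') (c * a' + d * c') (c * b' + d * d').
Proof. by apply: mx2P; rewrite !mxE !big_ord_recl big_ord0 !mxE /= addr0. Qed.

Lemma mx2_add (K : pzRingType) (a b c d a' b' c' d' : K) :
  mx2 a b c d + mx2 a' b' c' d' = mx2 (a + a') (b + b') (c + c') (d + d').
Proof. by apply: mx2P; rewrite !mxE. Qed.

Lemma mx2_scale (K : pzRingType) (k a b c d : K) :
  k *: mx2 a b c d = mx2 (k * a) (k * b) (k * c) (k * d).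
Proof. by apply: mx2P; rewrite !mxE. Qed.

Lemma mx2_scalar (K : pzRingType) (k : K) : k%:M = mx2 k 0 0 k.
Proof. by apply: mx2P; rewrite !mxE /= ?mulr1n ?mulr0n. Qed.

Lemma smx_add (R : realType) (h p q h' p' q' : R) :
  smx h p q + smx h' p' q' = smx (h + h') (p + p') (q + q').
Proof. by rewrite mx2_add /smx -!rmorphD; congr mx2; congr (_%:C); ring. Qed.

Lemma smx_scale (R : realType) (k h p q : R) :
  k%:C *: smx h p q = smx (k * h) (k * p) (k * q).
Proof. by rewrite mx2_scale /smx -!rmorphM; congr mx2; congr (_%:C); ring. Qed.

Lemma smx_opp (R : realType) (h p q : R) : - smx h p q = smx (- h) (- p) (- q).
Proof. by apply: mx2P; rewrite !mxE /= -?rmorphN; congr (_%:C); ring. Qed.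

Lemma smx_scalar (R : realType) (k : R) : (k%:C)%:M = smx k 0 0.
Proof. by rewrite mx2_scalar /smx addr0 subr0. Qed.

Lemma smx_one (R : realType) : 1%:M = smx (1 : R) 0 0.
Proof. by rewrite -smx_scalar rmorph1. Qed.

(** With [v = (p, q)], [w = (b, c)] and the matrices [V], [W] of these
    vectors, this is the expansion of [(h + V) (a + W) (h + V)] by [V V =
    |v|^2], [V W + W V = 2 (v . w)] and [V W V = 2 (v . w) V - |v|^2 W]. *)
Lemma smx_conj (R : realType) (h p q a b c : R) :
  smx h p q *m smx a b c *m smx h p q =
  smx (a * (h ^+ 2 + (p ^+ 2 + q ^+ 2)) + 2 * h * (p * b + q * c))
    (2 * (h * a + (p * b + q * c)) * p + (h ^+ 2 - (p ^+ 2 + q ^+ 2)) * b)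
    (2 * (h * a + (p * b + q * c)) * q + (h ^+ 2 - (p ^+ 2 + q ^+ 2)) * c).
Proof.
rewrite /smx !mx2_mul -!rmorphM -!rmorphD -!rmorphM -!rmorphD.
by congr mx2; congr (_%:C); ring.
Qed.

Lemma smx_mulV (R : realType) (h p q : R) :
  h ^+ 2 - (p ^+ 2 + q ^+ 2) = 1 -> smx h p q *m smx h (- p) (- q) = 1%:M.
Proof.
move=> h1; rewrite smx_one /smx !mx2_mul -!rmorphM -!rmorphD.
by congr mx2; congr (_%:C); rewrite ?addr0 ?subr0 -?h1; ring.
Qed.

Lemma smx_inv (R : realType) (h p q : R) :
  h ^+ 2 - (p ^+ 2 + q ^+ 2) = 1 -> invmx (smx h p q) = smx h (- p) (- q).
Proof.
move=> /smx_mulV e; have [u _] := mulmx1_unit e.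
by rewrite -[RHS]mul1mx -(mulVmx u) -mulmxA e mulmx1.
Qed.

Lemma smx_herm (R : realType) (h p q : R) : smx h p q \is hermsymmx.
Proof.
apply/is_hermitianmxP; rewrite expr0 scale1r.
by apply: mx2P; rewrite !mxE /=; apply: esym; apply: conjc_real.
Qed.

(** A quadratic polynomial that annihilates a diagonalizable matrix vanishes
    at each entry of the diagonal form. *)
Lemma diag_conj_root (K : fieldType) (n : nat) (P : 'M[K]_n) (d : 'rV[K]_n)
    (l m : K) (i : 'I_n) :
  P \in unitmx ->
  (invmx P *m diag_mx d *m P - l%:M) *m (invmx P *m diag_mx d *m P - m%:M) = 0 ->
  (d 0 i - l) * (d 0 i - m) = 0.
Proof.
move=> Pu.
have conj k : invmx P *m diag_mx d *m P - k%:M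
    = invmx P *m diag_mx (\row_j (d 0 j - k)) *m P.
  have -> : diag_mx (\row_j (d 0 j - k)) = diag_mx d - k%:M.
    by apply/matrixP => i' j'; rewrite !mxE mulrnBl.
  by rewrite mulmxBr mulmxBl scalar_mxC -[k%:M *m _ *m _]mulmxA mulVmx // mulmx1.
rewrite !conj -!mulmxA (mulKVmx Pu) => /(congr1 (mulmx P)).
rewrite (mulKVmx Pu) mulmx0 => /(congr1 (mulmxr (invmx P))) /=.
rewrite mul0mx !mulmxA (mulmxK Pu) mulmx_diag => /matrixP/(_ i i).
by rewrite !mxE eqxx mulr1n.
Qed.

(** The eigenvalues are among the roots [l], [m] of the annihilating
    polynomial, so [f] may be replaced by the affine function that agrees with
    it at these two points; an affine function commutes with the
    diagonalization, whichever one [spectralmx] returns. *)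
Lemma hermfun_affine (R : realType) (n : nat) (f : R -> R) (A : 'M[R[i]]_n)
    (a b l m : R) :
  A \is hermsymmx -> (A - (l%:C)%:M) *m (A - (m%:C)%:M) = 0 ->
  f l = a + b * l -> f m = a + b * m ->
  hermfun f A = (a%:C)%:M + b%:C *: A.
Proof.
move=> /hermitian_normalmx /orthomx_spectralP Aeq Aroot fl fm.
rewrite /hermfun; move: (spectral_unit A) Aeq.
move: (spectralmx A) (spectral_diag A) => P d Pu Aeq.
have droot i : (d 0 i - l%:C) * (d 0 i - m%:C) = 0.
  by apply: (diag_conj_root i Pu); rewrite -Aeq.
have -> : map_mx (fun z => (f (complex.Re z))%:C) d
    = \row_j (a%:C + b%:C * d 0 j).
  apply/rowP => j; rewrite !mxE.
  have := droot j; move/eqP; rewrite mulf_eq0 !subr_eq0.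
  by case/orP => /eqP -> /=; rewrite ?fl ?fm rmorphD rmorphM.
have -> : diag_mx (\row_j (a%:C + b%:C * d 0 j)) = (a%:C)%:M + b%:C *: diag_mx d.
  by apply/matrixP => i j; rewrite !mxE mulrnDl mulrnAr.
rewrite mulmxDr mulmxDl [in RHS]Aeq -scalemxAr -scalemxAl; congr (_ + _).
by rewrite scalar_mxC -mulmxA mulVmx // mulmx1.
Qed.

(** The eigenvalues of [smx h p q] are [h + d] and [h - d], and this is its
    Cayley-Hamilton identity. *)
Lemma smx_root (R : realType) (h p q d : R) : d ^+ 2 = p ^+ 2 + q ^+ 2 ->
  (smx h p q - ((h + d)%:C)%:M) *m (smx h p q - ((h - d)%:C)%:M) = 0.
Proof.
move=> dE.
have sub k : smx h p q - (k%:C)%:M = smx (h - k) p q.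
  by rewrite smx_scalar smx_opp smx_add oppr0 !addr0.
rewrite !sub /smx mx2_mul -!rmorphM -!rmorphD.
have -> : 0 = mx2 0 0 0 0 :> 'M[R[i]]_2 by apply: mx2P; rewrite !mxE.
by congr mx2; rewrite -[0]/(0%:C); congr (_%:C); ring: dE.
Qed.

Lemma smx_hermfun (R : realType) (f : R -> R) (h p q d a b : R) :
  d ^+ 2 = p ^+ 2 + q ^+ 2 ->
  f (h + d) = a + b * (h + d) -> f (h - d) = a + b * (h - d) ->
  hermfun f (smx h p q) = smx (a + b * h) (b * p) (b * q).
Proof.
move=> dE f1 f2; rewrite (hermfun_affine (smx_herm h p q) (smx_root h dE) f1 f2).
by rewrite smx_scale smx_scalar smx_add !add0r.
Qed.
(** At determinant one the two eigenvalues are inverse to each other with sum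
    [2 h], and [(l + 1) ^+ 2 = (2 h + 2) l] for both of them: the square root
    is [(M + 1) / Num.sqrt (\tr M + 2)]. *)
Lemma smx_sqrt (R : realType) (h p q : R) :
  0 < h -> h ^+ 2 - (p ^+ 2 + q ^+ 2) = 1 ->
  let t := (Num.sqrt (2 * h + 2))^-1 in
  mxsqrt (smx h p q) = smx (t * (h + 1)) (t * p) (t * q).
Proof.
move=> h0 hD t; set d := Num.sqrt (p ^+ 2 + q ^+ 2).
have dE : d ^+ 2 = p ^+ 2 + q ^+ 2 by rewrite sqr_sqrtr // addr_ge0 ?sqr_ge0.
have hd : d ^+ 2 = h ^+ 2 - 1 by rewrite dE -hD; ring.
have root l : 0 <= l -> l ^+ 2 + 1 = 2 * h * l -> Num.sqrt l = t + t * l.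
  move=> l0 lE; have t0 : 0 <= t + t * l.
    by rewrite addr_ge0 ?mulr_ge0 // invr_ge0 sqrtr_ge0.
  rewrite -[RHS]ger0_norm // -sqrtr_sqr; congr Num.sqrt.
  rewrite (_ : _ ^+ 2 = t ^+ 2 * (1 + l) ^+ 2); last by ring.
  rewrite exprVn sqr_sqrtr; last by lra.
  rewrite (_ : (1 + l) ^+ 2 = (2 * h + 2) * l); last by lra.
  by rewrite mulKf //; lra.
rewrite [LHS](@smx_hermfun _ _ h p q d t t) //.
- by congr smx; ring.
- by apply: root; [have := sqrtr_ge0 (p ^+ 2 + q ^+ 2); rewrite -/d; lra|ring: hd].
- apply: root; last by ring: hd.
  rewrite subr_ge0 -ler_sqr ?nnegrE ?sqrtr_ge0 ?ltW //; lra.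
Qed.

(** The eigenvalues [h + d] and [h - d] are inverse to each other, so their
    logarithms are opposite. *)
Lemma smx_log (R : realType) (h p q d : R) :
  0 < h -> 0 < d -> d ^+ 2 = p ^+ 2 + q ^+ 2 -> h ^+ 2 - d ^+ 2 = 1 ->
  mxlog (smx h p q) = smx 0 (ln (h + d) / d * p) (ln (h + d) / d * q).
Proof.
move=> h0 d0 dE hd.
rewrite [LHS](@smx_hermfun _ _ h p q d (- (ln (h + d) / d * h)) (ln (h + d) / d)) //.
- by congr smx; ring.
- by field; rewrite gt_eqF.
- have -> : h - d = (h + d)^-1.
    have hd0 : h + d != 0 by rewrite gt_eqF // addr_gt0.
    by apply: (mulIf hd0); rewrite mulVf //; lra.
  rewrite lnV ?posrE ?addr_gt0 //.
  have -> : (h + d)^-1 = h - d.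
    have hd0 : h + d != 0 by rewrite gt_eqF // addr_gt0.
    by apply: (mulIf hd0); rewrite mulVf //; lra.
  by field; rewrite gt_eqF.
Qed.

Lemma smx_sqrt_mul (R : realType) (h p q k : R) :
  h ^+ 2 - (p ^+ 2 + q ^+ 2) = 1 -> k ^+ 2 * (2 * h + 2) = 1 ->
  smx (k * (h + 1)) (k * p) (k * q) *m smx (k * (h + 1)) (k * p) (k * q)
  = smx h p q.
Proof.
move=> hD k2; have p2 : p ^+ 2 = h ^+ 2 - 1 - q ^+ 2 by lra.
have kE x : k ^+ 2 * (2 * h + 2) * x = x by rewrite k2 mul1r.
have := smx_conj (k * (h + 1)) (k * p) (k * q) 1 0 0.
by rewrite -smx_one mulmx1 => ->; congr smx; rewrite -[RHS]kE; ring: p2.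
Qed.

(** The reversed Cauchy-Schwarz inequality between two points on the same
    sheet of the hyperboloid; only the sign is kept. *)
Lemma hyperboloid_dot_gt0 (R : realType) (h p q a b c : R) :
  0 < h -> h ^+ 2 - (p ^+ 2 + q ^+ 2) = 1 ->
  0 < a -> a ^+ 2 - (b ^+ 2 + c ^+ 2) = 1 ->
  0 < h * a - (p * b + q * c).
Proof.
move=> h0 hD a0 aD; rewrite subr_gt0; apply: le_lt_trans (ler_norm _) _.
rewrite -ltr_sqr ?nnegrE ?normr_ge0 ?mulr_ge0 ?ltW // real_normK ?num_real //.
have e1 : h ^+ 2 = 1 + (p ^+ 2 + q ^+ 2) by lra.
have e2 : a ^+ 2 = 1 + (b ^+ 2 + c ^+ 2) by lra.
rewrite [X in _ < X]exprMn e1 e2.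
have := sqr_ge0 (p * c - q * b); have := sqr_ge0 p; have := sqr_ge0 q.
have := sqr_ge0 b; have := sqr_ge0 c; lra.
Qed.

(** Congruence by a matrix of determinant one keeps positivity and the
    determinant; the triple is the one in [smx_conj]. *)
Lemma hyperboloid_conj (R : realType) (h p q a b c : R) :
  0 < h -> h ^+ 2 - (p ^+ 2 + q ^+ 2) = 1 ->
  0 < a -> a ^+ 2 - (b ^+ 2 + c ^+ 2) = 1 ->
  let H := a * (h ^+ 2 + (p ^+ 2 + q ^+ 2)) + 2 * h * (p * b + q * c) in
  let P := 2 * (h * a + (p * b + q * c)) * p
    + (h ^+ 2 - (p ^+ 2 + q ^+ 2)) * b in
  let Q := 2 * (h * a + (p * b + q * c)) * q
    + (h ^+ 2 - (p ^+ 2 + q ^+ 2)) * c in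
  0 < H /\ H ^+ 2 - (P ^+ 2 + Q ^+ 2) = 1.
Proof.
move=> h0 hD a0 aD H P Q.
have h2 : h ^+ 2 = 1 + (p ^+ 2 + q ^+ 2) by lra.
split.
  have vD : (h ^+ 2 + (p ^+ 2 + q ^+ 2)) ^+ 2
      - ((2 * h * p) ^+ 2 + (2 * h * q) ^+ 2) = 1 by ring: h2.
  have wD : a ^+ 2 - ((- b) ^+ 2 + (- c) ^+ 2) = 1 by rewrite !sqrrN.
  have v0 : 0 < h ^+ 2 + (p ^+ 2 + q ^+ 2).
    by rewrite ltr_pwDl ?exprn_gt0 // addr_ge0 ?sqr_ge0.
  by have := hyperboloid_dot_gt0 v0 vD a0 wD; rewrite /H; lra.
transitivity
  ((h ^+ 2 - (p ^+ 2 + q ^+ 2)) ^+ 2 * (a ^+ 2 - (b ^+ 2 + c ^+ 2))).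
  by rewrite /H /P /Q; ring.
by rewrite hD aD expr1n mulr1.
Qed.

(** Let [M] be the square root of the first matrix [A] and [C = M^-1 B M^-1].
    As [C] has determinant one, its square root is [t (C + 1)], and [M (C + 1)
    M = B + A]. *)
Lemma smx_gmean (R : realType) (h p q a b c : R) :
  0 < h -> h ^+ 2 - (p ^+ 2 + q ^+ 2) = 1 ->
  0 < a -> a ^+ 2 - (b ^+ 2 + c ^+ 2) = 1 ->
  let t := (Num.sqrt ((h + a) ^+ 2 - ((p + b) ^+ 2 + (q + c) ^+ 2)))^-1 in
  gmean (smx h p q) (smx a b c) = smx (t * (h + a)) (t * (p + b)) (t * (q + c)).
Proof.
move=> h0 hD a0 aD /=.
have pos := hyperboloid_dot_gt0 h0 hD a0 aD.
have -> : (h + a) ^+ 2 - ((p + b) ^+ 2 + (q + c) ^+ 2)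
    = 2 * (h * a - (p * b + q * c)) + 2 by lra.
have hp : 0 < 2 * h + 2 by lra.
rewrite /gmean smx_sqrt //; set k := (Num.sqrt (2 * h + 2))^-1.
have k2 : k ^+ 2 * (2 * h + 2) = 1.
  by rewrite exprVn sqr_sqrtr ?ltW // mulVf // gt_eqF.
have kE x : k ^+ 2 * (2 * h + 2) * x = x by rewrite k2 mul1r.
have p2 : p ^+ 2 = h ^+ 2 - 1 - q ^+ 2 by lra.
have MM := smx_sqrt_mul hD k2.
have MD : (k * (h + 1)) ^+ 2 - ((k * p) ^+ 2 + (k * q) ^+ 2) = 1.
  by rewrite -[RHS]kE; ring: p2.
have [MMV MVM] : smx (k * (h + 1)) (k * p) (k * q) *m
      smx (k * (h + 1)) (- (k * p)) (- (k * q)) = 1%:M /\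
    smx (k * (h + 1)) (- (k * p)) (- (k * q)) *m
      smx (k * (h + 1)) (k * p) (k * q) = 1%:M.
  by have e := smx_mulV MD; split=> //; apply: mulmx1C.
rewrite smx_inv //.
move: MM MMV MVM; set M := smx _ (k * p) _; set N := smx _ (- _) _ => MM MMV MVM.
have CE := smx_conj (k * (h + 1)) (- (k * p)) (- (k * q)) a b c.
move: CE; rewrite -/N.
set H := a * _ + _; set P := _ + _ * b; set Q := _ + _ * c => CE.
have HE : H = h * a - (p * b + q * c).
  by rewrite -[RHS]kE /H; ring: p2.
have MD' : (k * (h + 1)) ^+ 2 - ((- (k * p)) ^+ 2 + (- (k * q)) ^+ 2) = 1.
  by rewrite !sqrrN.
have k0 : 0 < k * (h + 1).
  by apply: mulr_gt0; [rewrite invr_gt0 sqrtr_gt0|lra].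
have [H0 HD] : 0 < H /\ H ^+ 2 - (P ^+ 2 + Q ^+ 2) = 1.
  exact: hyperboloid_conj k0 MD' a0 aD.
rewrite CE smx_sqrt // -HE; set t := (Num.sqrt _)^-1.
have -> : smx (t * (H + 1)) (t * P) (t * Q) = t%:C *: (smx H P Q + 1%:M).
  by rewrite smx_one smx_add smx_scale !addr0.
rewrite -CE -scalemxAr -scalemxAl mulmxDr mulmxDl mulmx1 MM.
rewrite !mulmxA MMV mul1mx -mulmxA MVM mulmx1 addrC smx_add smx_scale.
by [].
Qed.

(** Cayley-Hamilton for [B X], which has determinant one, gives [B X + (B
    X)^-1 = \tr (B X)], hence [B X B + X^-1 = \tr (B X) B]. *)
Lemma smx_gmean_conj (R : realType) (h p q a b c : R) :
  0 < h -> h ^+ 2 - (p ^+ 2 + q ^+ 2) = 1 ->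
  0 < a -> a ^+ 2 - (b ^+ 2 + c ^+ 2) = 1 ->
  gmean (smx h p q *m smx a b c *m smx h p q) (invmx (smx a b c)) = smx h p q.
Proof.
move=> h0 hD a0 aD; rewrite smx_inv // smx_conj.
have h2 : h ^+ 2 = 1 + (p ^+ 2 + q ^+ 2) by lra.
have hD' : h ^+ 2 - ((- p) ^+ 2 + (- q) ^+ 2) = 1 by rewrite !sqrrN.
have := hyperboloid_dot_gt0 h0 hD' a0 aD.
set m := _ - _ => m0.
set H := a * _ + _; set P := _ + _ * b; set Q := _ + _ * c.
have HE : H + a = 2 * m * h by rewrite /H /m; ring: h2.
have PE : P - b = 2 * m * p by rewrite /P /m; ring: h2.
have QE : Q - c = 2 * m * q by rewrite /Q /m; ring: h2.
have [H0 HD] : 0 < H /\ H ^+ 2 - (P ^+ 2 + Q ^+ 2) = 1.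
  exact: hyperboloid_conj h0 hD a0 aD.
have wD : a ^+ 2 - ((- b) ^+ 2 + (- c) ^+ 2) = 1 by rewrite !sqrrN.
rewrite smx_gmean // HE PE QE.
have -> : (2 * m * h) ^+ 2 - ((2 * m * p) ^+ 2 + (2 * m * q) ^+ 2) = (2 * m) ^+ 2.
  by ring: h2.
have m2 : 0 < 2 * m by lra.
rewrite sqrtr_sqr gtr0_norm //.
by congr smx; rewrite mulrA mulVf ?mul1r // gt_eqF.
Qed.

(** The matrix is the square of the Hermitian matrix [M] of [smx_sqrt_mul], so
    the form is [|M v|^2]. *)
Lemma smx_posdef (R : realType) (h p q : R) :
  0 < h -> h ^+ 2 - (p ^+ 2 + q ^+ 2) = 1 -> posdefmx (smx h p q).
Proof.
move=> h0 hD; split; first exact: smx_herm.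
move=> v v0; set k := (Num.sqrt (2 * h + 2))^-1.
have k2 : k ^+ 2 * (2 * h + 2) = 1.
  have hp : 0 < 2 * h + 2 by lra.
  by rewrite exprVn sqr_sqrtr ?ltW // mulVf // gt_eqF.
rewrite -(smx_sqrt_mul hD k2); set M := smx (k * _) _ _.
have MH : M ^t* = M.
  by move/is_hermitianmxP: (smx_herm (k * (h + 1)) (k * p) (k * q));
    rewrite expr0 scale1r => <-.
have Mv0 : M *m v != 0.
  apply/negP => /eqP e; move/negP: v0; apply; apply/eqP.
  have : smx h (- p) (- q) *m (M *m (M *m v)) = 0 by rewrite e !mulmx0.
  rewrite [M *m (M *m v)]mulmxA (smx_sqrt_mul hD k2) mulmxA.
  by rewrite (mulmx1C (smx_mulV hD)) mul1mx.
have -> : v ^t* *m (M *m M) *m v = (M *m v) ^t* *m (M *m v).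
  by rewrite trmx_mul map_mxM MH !mulmxA.
move: (M *m v) Mv0 => w w0.
rewrite mxE lt_neqAle eq_sym; apply/andP; split; last first.
  by apply: sumr_ge0 => i _; rewrite !mxE mulrC mul_conjC_ge0.
apply: contra w0 => /eqP s0; apply/eqP/colP => i; rewrite mxE.
have := @psumr_eq0P _ _ predT (fun i => (w ^t*) 0 i * w i 0) _ s0 i isT.
rewrite !mxE mulrC => e; apply/eqP; rewrite -mul_conjC_eq0 e //.
by move=> j _; rewrite !mxE mulrC mul_conjC_ge0.
Qed.

(** * The exponential of a traceless symmetric matrix *)

(** Convergence on the spectral projections [E] and [F] reduces to that of two
    scalar sequences. *)
Lemma mxexp_eqP (K : numFieldType) (n : nat) (A E F : 'M[K]_n.+1)
    (u v : nat -> K) (x y : K) :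
  (u @ \oo --> x)%classic -> (v @ \oo --> y)%classic ->
  (forall k, series (fun k : nat => (k`!%:R)^-1 *: A ^+ k) k
    = u k *: E + v k *: F) ->
  mxexp A = x *: E + y *: F.
Proof.
move=> ux vy serE; rewrite /mxexp.
have -> : series (fun k : nat => (k`!%:R)^-1 *: A ^+ k)
    = (fun k => u k *: E + v k *: F).
  exact/funext.
apply: cvg_lim; first exact: norm_hausdorff.
by apply: cvgD; apply: cvgZr_tmp.
Qed.

Lemma cvg_real_complex (R : realType) (u : nat -> R) (l : R) :
  (u @ \oo --> l)%classic ->
  cvg_to (nbhs ((fun n => (u n)%:C : (R[i] : numFieldType)) @ \oo)%classic)
    (nbhs (l%:C : (R[i] : numFieldType))).
Proof.
move=> /cvgrPdist_lt ul; apply/(@cvgrPdist_lt (R[i] : numFieldType)) => e.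
case: e => [a b]; rewrite ltcE /= => /andP[/eqP -> a0].
near=> n; rewrite -rmorphB normc_def /= expr0n /= addr0 sqrtr_sqr ltcR.
near: n; exact: ul.
Unshelve. all: by end_near. Qed.

(** With [N = smx 0 (p / d) (q / d)], which squares to one, the powers of [d
    N] split along the two projections [(1 + N) / 2] and [(1 - N) / 2], where
    they are the powers of [d] and [- d]. *)
Lemma smx0_exp (R : realType) (p q d : R) : 0 < d -> d ^+ 2 = p ^+ 2 + q ^+ 2 ->
  mxexp (smx 0 p q) =
  smx ((expR d + expR (- d)) / 2) ((expR d - expR (- d)) / 2 / d * p)
    ((expR d - expR (- d)) / 2 / d * q).
Proof.
move=> d0 dE; have d0' : d != 0 by rewrite gt_eqF.
have q2 : q ^+ 2 = d ^+ 2 - p ^+ 2 by rewrite dE; ring.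
pose Ep := smx (1 / 2) (p / (2 * d)) (q / (2 * d)).
pose Em := smx (1 / 2) (- p / (2 * d)) (- q / (2 * d)).
have pow k : smx 0 p q ^+ k = (d ^+ k)%:C *: Ep + ((- d) ^+ k)%:C *: Em.
  elim: k => [|k IH].
    rewrite !expr0 !smx_scale smx_add -[1]/(1%:M) smx_one.
    by congr smx; field.
  rewrite exprS IH -[_ * _]/(_ *m _) !smx_scale !smx_add !exprS /smx mx2_mul.
  rewrite -!rmorphM -!rmorphD; move: (d ^+ k) ((- d) ^+ k) => x y.
  by congr mx2; congr (_%:C); field: q2.
have -> : smx ((expR d + expR (- d)) / 2) ((expR d - expR (- d)) / 2 / d * p)
    ((expR d - expR (- d)) / 2 / d * q)
  = (expR d)%:C *: Ep + (expR (- d))%:C *: Em.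
  by rewrite !smx_scale smx_add; congr smx; field.
apply: (@mxexp_eqP _ _ _ Ep Em (fun n => (series (exp_coeff d) n)%:C)
  (fun n => (series (exp_coeff (- d)) n)%:C)).
- by apply: cvg_real_complex; apply: is_cvg_series_exp_coeff.
- by apply: cvg_real_complex; apply: is_cvg_series_exp_coeff.
move=> n; rewrite /series /= !rmorph_sum !scaler_suml -big_split /=.
apply: eq_bigr => k _; rewrite pow scalerDr !scalerA.
by rewrite /exp_coeff /= !rmorphM /= !fmorphV !rmorph_nat ![_ / _]mulrC.
Qed.

(** * The coefficients of the logarithms *)

Definition artanh (R : realType) (t : R) : R := (ln (1 + t) - ln (1 - t)) / 2.

Lemma artanh_mvt (R : realType) (s t : R) : 0 <= s -> s < t -> t < 1 ->
  exists2 x, s < x < t & artanh t - artanh s = (1 - x ^+ 2)^-1 * (t - s).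
Proof.
move=> s0 st t1.
have der (x : R) : 0 <= x -> x < 1 ->
    is_derive x 1 (@artanh R) (1 - x ^+ 2)^-1.
  move=> x0 x1.
  have hp : 0 < 1 + x by lra.
  have hm : 0 < 1 - x by lra.
  have dp := is_deriveD (is_derive_cst (1 : R) x 1) (is_derive_id x (1 : R)).
  have dm := is_deriveB (is_derive_cst (1 : R) x 1) (is_derive_id x (1 : R)).
  have d1 := @is_derive1_comp R (@ln R) (cst 1 + id) x _ _ (is_derive1_ln hp) dp.
  have d2 := @is_derive1_comp R (@ln R) (cst 1 - id) x _ _ (is_derive1_ln hm) dm.
  have -> : @artanh R
      = (2^-1 : R) *: ((@ln R \o (cst 1 + id)) - (@ln R \o (cst 1 - id))).
    by apply/funext => y; rewrite /artanh /= mulrC.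
  apply: (is_derive_eq (is_deriveZ (2^-1 : R) (is_deriveB d1 d2))).
  have hx : 1 - x ^+ 2 != 0 by rewrite gt_eqF //; nra.
  by rewrite /GRing.scale /=; field; rewrite hx !gt_eqF.
have [||x xst ->] := @MVT R (@artanh R) (fun x => (1 - x ^+ 2)^-1) s t st.
- move=> x; rewrite in_itv /= => /andP[sx xt]; apply: der; lra.
- apply: derivable_within_continuous => x; rewrite in_itv /= => /andP[sx xt].
  by have [] : is_derive x 1 (@artanh R) (1 - x ^+ 2)^-1 by apply: der; lra.
by exists x => //; move: xst; rewrite in_itv.
Qed.

Lemma artanh0 (R : realType) : artanh (0 : R) = 0.
Proof. by rewrite /artanh addr0 subr0 subrr mul0r. Qed.

(** [artanh] is convex on the nonnegative half of its domain and vanishes at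
    zero, so its chord slopes from zero increase. *)
Lemma artanh_div_le (R : realType) (s t : R) : 0 < s -> s <= t -> t < 1 ->
  artanh s / s <= artanh t / t.
Proof.
move=> s0; rewrite le_eqVlt => /orP[/eqP -> //|st] t1.
have s1 : s < 1 by lra.
have [x /andP[x0 xs]] := artanh_mvt (lexx 0) s0 s1.
have [y /andP[sy yt]] := artanh_mvt (ltW s0) st t1.
rewrite artanh0 !subr0 => ey ex.
have t0 : 0 < t by lra.
rewrite ler_pdivrMr // mulrAC ler_pdivlMr //.
have -> : artanh t = (1 - y ^+ 2)^-1 * (t - s) + artanh s by rewrite -ey; ring.
rewrite ex.
suff : (1 - x ^+ 2)^-1 <= (1 - y ^+ 2)^-1.
  move: ((1 - x ^+ 2)^-1) ((1 - y ^+ 2)^-1) => u v uv.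
  have : 0 <= (v - u) * (t - s) * s.
    by rewrite mulr_ge0 ?(ltW s0) // mulr_ge0 // subr_ge0 // ltW.
  lra.
by rewrite lef_pV2 ?posrE; nra.
Qed.

Lemma artanh_gt0 (R : realType) (t : R) : 0 < t -> t < 1 -> 0 < artanh t.
Proof.
move=> t0 t1; have [x /andP[x0 xt]] := artanh_mvt (lexx 0) t0 t1.
rewrite artanh0 !subr0 => ->; rewrite mulr_gt0 // invr_gt0; nra.
Qed.

Definition hgt (R : realType) (P Q : R) : R := Num.sqrt (1 + (P ^+ 2 + Q ^+ 2)).

(** Let [A = smx a p b] and [Y = smx (hgt P Q) P Q] have determinant one.
    Then [A + Y] has eigenvalues [a + hgt P Q + gap p b P Q] and [a + hgt P Q
    - gap p b P Q], and [hdet a p b P Q] is its determinant. *)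
Definition gap (R : realType) (p b P Q : R) : R :=
  Num.sqrt ((p + P) ^+ 2 + (b + Q) ^+ 2).

Definition hdet (R : realType) (a p b P Q : R) : R :=
  2 * (1 + a * hgt P Q - p * P - b * Q).

(** The logarithm of the geometric mean of [A] and [Y] is this multiple of
    [smx 0 (p + P) (b + Q)]; see [log_gmean]. *)
Definition weight (R : realType) (a p b P Q : R) : R :=
  ln ((a + hgt P Q + gap p b P Q) / Num.sqrt (hdet a p b P Q)) / gap p b P Q.

Lemma sqr_hgt (R : realType) (P Q : R) : hgt P Q ^+ 2 = 1 + (P ^+ 2 + Q ^+ 2).
Proof. by rewrite sqr_sqrtr // addr_ge0 // addr_ge0 // sqr_ge0. Qed.

Lemma hgt_gt0 (R : realType) (P Q : R) : 0 < hgt P Q.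
Proof. by rewrite sqrtr_gt0 ltr_pwDl // addr_ge0 // sqr_ge0. Qed.

Lemma sqr_gap (R : realType) (p b P Q : R) :
  gap p b P Q ^+ 2 = (p + P) ^+ 2 + (b + Q) ^+ 2.
Proof. by rewrite sqr_sqrtr // addr_ge0 // sqr_ge0. Qed.

Lemma hdetE (R : realType) (a p b P Q : R) : a ^+ 2 - (p ^+ 2 + b ^+ 2) = 1 ->
  (a + hgt P Q) ^+ 2 - gap p b P Q ^+ 2 = hdet a p b P Q.
Proof. by move=> aD; rewrite sqr_gap /hdet; have := sqr_hgt P Q; lra. Qed.

Lemma hdet_gt0 (R : realType) (a p b P Q : R) : 0 < a ->
  a ^+ 2 - (p ^+ 2 + b ^+ 2) = 1 -> 0 < hdet a p b P Q.
Proof.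
move=> a0 aD; have hD : hgt P Q ^+ 2 - (P ^+ 2 + Q ^+ 2) = 1.
  by rewrite sqr_hgt; ring.
have := hyperboloid_dot_gt0 a0 aD (hgt_gt0 P Q) hD; rewrite /hdet; lra.
Qed.

Lemma gap_lt (R : realType) (a p b P Q : R) : 0 < a ->
  a ^+ 2 - (p ^+ 2 + b ^+ 2) = 1 -> gap p b P Q < a + hgt P Q.
Proof.
move=> a0 aD; rewrite -ltr_sqr ?nnegrE ?sqrtr_ge0 //; last first.
  by rewrite addr_ge0 // ltW // hgt_gt0.
by rewrite -subr_gt0 hdetE // hdet_gt0.
Qed.

(** Half the logarithm of the ratio of the eigenvalues [m + d] and [m - d]. *)
Lemma artanh_ln (R : realType) (m d : R) : 0 < d -> d < m ->
  ln ((m + d) / Num.sqrt (m ^+ 2 - d ^+ 2)) = artanh (d / m).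
Proof.
move=> d0 dm; have m0 : 0 < m by lra.
have s0 : 0 < m ^+ 2 - d ^+ 2 by rewrite subr_sqr mulr_gt0 //; lra.
have r0 : 0 < Num.sqrt (m ^+ 2 - d ^+ 2) by rewrite sqrtr_gt0.
have md0 : 0 < m + d by rewrite addr_gt0.
have dm0 : 0 < m - d by rewrite subr_gt0.
rewrite ln_div ?posrE //.
have -> : ln (Num.sqrt (m ^+ 2 - d ^+ 2)) = (ln (m + d) + ln (m - d)) / 2.
  rewrite -lnM ?posrE //.
  set s := Num.sqrt _; have -> : ln s = (ln s + ln s) / 2 by lra.
  rewrite -lnM ?posrE //.
  by rewrite -expr2 sqr_sqrtr ?ltW //; congr (ln _ / _); ring.
have tp : 1 + d / m = (m + d) / m by field; rewrite gt_eqF.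
have tm : 1 - d / m = (m - d) / m by field; rewrite gt_eqF.
rewrite /artanh tp tm !ln_div ?posrE //; lra.
Qed.

(** In this form the dependence on [P] and [Q] is through the ratio [t] and
    the half trace [m] only, and both are easy to compare at two points. *)
Lemma weightE (R : realType) (a p b P Q : R) : 0 < a ->
  a ^+ 2 - (p ^+ 2 + b ^+ 2) = 1 -> 0 < gap p b P Q ->
  let m := a + hgt P Q in let t := gap p b P Q / m in
  [/\ 0 < t, t < 1, t ^+ 2 = 1 - hdet a p b P Q / m ^+ 2
    & weight a p b P Q = artanh t / t / m].
Proof.
move=> a0 aD d0 m t.
have m0 : 0 < m by rewrite addr_gt0 // hgt_gt0.
have s0 := hdet_gt0 P Q a0 aD; have dm := gap_lt P Q a0 aD.
have sE := hdetE P Q aD; rewrite -/m in dm sE.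
split; first by rewrite divr_gt0.
- by rewrite ltr_pdivrMr // mul1r.
- by rewrite -sE /t; field; rewrite gt_eqF.
have -> : artanh t / t / m = artanh t / gap p b P Q.
  by rewrite /t; field; rewrite !gt_eqF.
rewrite /weight -/m; congr (_ / _).
by rewrite -sE artanh_ln.
Qed.

Lemma weight_gt0 (R : realType) (a p b P Q : R) : 0 < a ->
  a ^+ 2 - (p ^+ 2 + b ^+ 2) = 1 -> 0 < gap p b P Q -> 0 < weight a p b P Q.
Proof.
move=> a0 aD d0; have [t0 t1 _ ->] := weightE a0 aD d0.
have m0 : 0 < a + hgt P Q by rewrite addr_gt0 // hgt_gt0.
apply: (divr_gt0 _ m0); apply: (divr_gt0 _ t0); exact: artanh_gt0.
Qed.

Lemma le_of_sqr (R : realType) (x y : R) : 0 <= y -> x ^+ 2 <= y ^+ 2 -> x <= y.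
Proof. by move=> y0 xy; rewrite leNgt; apply/negP => yx; nra. Qed.

(** On nonpositive [Q] the height is decreasing and 1-Lipschitz. *)
Lemma hgt_decr (R : realType) (P Q Q' : R) : Q <= Q' -> Q' <= 0 ->
  hgt P Q' <= hgt P Q <= hgt P Q' + (Q' - Q).
Proof.
move=> QQ Q0; have h := sqr_hgt P Q; have h' := sqr_hgt P Q'.
have h0 := hgt_gt0 P Q; have h0' := hgt_gt0 P Q'.
have k : - Q' <= hgt P Q'.
  apply: le_of_sqr; first exact: ltW.
  by rewrite sqrrN h'; have := sqr_ge0 P; lra.
apply/andP; split; apply: le_of_sqr; try exact: ltW; try lra.
  by rewrite h h'; nra.
by rewrite sqrrD h h'; nra.
Qed.

(** The ratio [- Q / hgt P Q] decreases as [Q] increases to zero. *)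
Lemma hgt_slope (R : realType) (P Q Q' : R) : Q <= Q' -> Q' <= 0 ->
  - Q' * hgt P Q <= - Q * hgt P Q'.
Proof.
move=> QQ Q0; have h0 := hgt_gt0 P Q; have h0' := hgt_gt0 P Q'.
apply: le_of_sqr; first by apply: mulr_ge0; [lra|exact: ltW].
have w : 0 <= (Q ^+ 2 - Q' ^+ 2) * (1 + P ^+ 2).
  by apply: mulr_ge0; [nra | rewrite addr_ge0 // sqr_ge0].
by rewrite !exprMn !sqr_hgt !sqrrN; lra.
Qed.

(** As [Q] increases to zero with [b + Q] nonnegative, the gap increases and
    the half trace decreases, so both factors [artanh t / t] and [1 / m] of
    [weightE] increase. *)
Lemma weight_incr (R : realType) (a p b P Q Q' : R) : 0 < a ->
  a ^+ 2 - (p ^+ 2 + b ^+ 2) = 1 -> 0 < gap p b P Q ->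
  0 <= b + Q -> Q <= Q' -> Q' <= 0 -> weight a p b P Q <= weight a p b P Q'.
Proof.
move=> a0 aD d0 bQ QQ Q0.
have dd : gap p b P Q <= gap p b P Q'.
  rewrite -ler_sqr ?nnegrE ?sqrtr_ge0 // !sqr_gap lerD2l ler_sqr ?nnegrE; lra.
have d0' := lt_le_trans d0 dd.
have [t0 t1 _ ->] := weightE a0 aD d0; have [t0' t1' _ ->] := weightE a0 aD d0'.
have /andP[hh _] := hgt_decr P QQ Q0.
have m0 : 0 < a + hgt P Q by rewrite addr_gt0 // hgt_gt0.
have m0' : 0 < a + hgt P Q' by rewrite addr_gt0 // hgt_gt0.
have i0 : 0 <= (a + hgt P Q)^-1 by rewrite invr_ge0 ltW.
have ii : (a + hgt P Q)^-1 <= (a + hgt P Q')^-1 by rewrite lef_pV2 ?posrE // lerD2l.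
have tt := ler_pM (ltW d0) i0 dd ii.
apply: (ler_pM _ i0 (artanh_div_le t0 tt t1') ii).
by rewrite divr_ge0 ?ltW ?artanh_gt0.
Qed.

(** The quotient of [al - be * Q] by the half trace decreases: the height is
    1-Lipschitz in [Q] and [al < be * a].  If [b] is negative enough, the
    determinant [hdet] increases while the half trace decreases, so that [t ^+
    2 = 1 - hdet / m ^+ 2] in [weightE] decreases as well. *)
Lemma weight_scaled_decr (R : realType) (a p b P Q Q' al be : R) : 0 < a ->
  a ^+ 2 - (p ^+ 2 + b ^+ 2) = 1 ->
  0 < gap p b P Q -> 0 < gap p b P Q' ->
  a <= - 2 * b -> - 2 * Q <= hgt P Q -> - 2 * Q' <= hgt P Q' ->
  Q < Q' -> Q' <= 0 -> 0 < al -> al < be * a ->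
  (al - be * Q') * weight a p b P Q' < (al - be * Q) * weight a p b P Q.
Proof.
move=> a0 aD d0 d0' ab qh qh' QQ Q0 al0 alb.
have be0 : 0 < be by nra.
have [t0 t1 tE ->] := weightE a0 aD d0; have [t0' t1' tE' ->] := weightE a0 aD d0'.
have /andP[hh hl] := hgt_decr P (ltW QQ) Q0.
have sl := hgt_slope P (ltW QQ) Q0.
have h0 := hgt_gt0 P Q; have h0' := hgt_gt0 P Q'.
have m0 : 0 < a + hgt P Q by rewrite addr_gt0.
have m0' : 0 < a + hgt P Q' by rewrite addr_gt0.
(* Multiplied by [hgt P Q + hgt P Q'], the difference of the heights becomes a
   difference of squares. *)
have ss : hdet a p b P Q <= hdet a p b P Q'.
  have dif : (hgt P Q - hgt P Q') * (hgt P Q + hgt P Q') = (Q' - Q) * (- Q - Q').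
    by rewrite -subr_sqr !sqr_hgt; ring.
  have : a * (hgt P Q - hgt P Q') <= - b * (Q' - Q).
    rewrite -(ler_pM2r (_ : 0 < hgt P Q + hgt P Q')) ?addr_gt0 //.
    have k1 : 0 <= (- 2 * b - a) * (- Q - Q') by apply: mulr_ge0; lra.
    have k2 : 0 <= - b * (hgt P Q + hgt P Q' + 2 * Q + 2 * Q').
      by apply: mulr_ge0; lra.
    have k3 : 0 <= (Q' - Q) * (- b * (hgt P Q + hgt P Q') - a * (- Q - Q')).
      by apply: mulr_ge0; lra.
    by rewrite -mulrA dif; lra.
  by rewrite /hdet; lra.
set t := _ / _ in t0 t1 tE *; set t' := _ / (a + hgt P Q') in t0' t1' tE' *.
have tt : t' <= t.
  apply: le_of_sqr; first exact: ltW.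
  rewrite tE tE' lerD2l lerN2.
  have i0 : 0 <= ((a + hgt P Q) ^+ 2)^-1 by rewrite invr_ge0 sqr_ge0.
  apply: (ler_pM (ltW (hdet_gt0 P Q a0 aD)) i0 ss).
  rewrite lef_pV2 ?posrE ?exprn_gt0 //; nra.
have psi := artanh_div_le t0' tt t1.
have psi0 : 0 < artanh t' / t' by rewrite divr_gt0 ?artanh_gt0.
rewrite (mulrCA (al - be * Q')) (mulrCA (al - be * Q)).
have key : (al - be * Q') / (a + hgt P Q') < (al - be * Q) / (a + hgt P Q).
  rewrite ltr_pdivrMr // mulrAC ltr_pdivlMr //.
  have k1 := ler_wpM2l (ltW al0) hl; have k2 := ler_wpM2l (ltW be0) sl.
  have k3 : 0 < (be * a - al) * (Q' - Q) by apply: mulr_gt0; lra.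
  lra.
have key0 : 0 < (al - be * Q) / (a + hgt P Q) by apply: (divr_gt0 _ m0); nra.
apply: lt_le_trans (_ : artanh t' / t' * ((al - be * Q) / (a + hgt P Q)) <= _).
  by rewrite ltr_pM2l.
by rewrite ler_pM2r.
Qed.

(** * Common zeros of two functions on a rectangle *)

Lemma IVT_le_ge (R : realType) (f : R -> R) (a b : R) :
  a <= b -> (forall x, {for x, continuous f}) -> f a <= 0 -> 0 <= f b ->
  exists2 c, a <= c <= b & f c = 0.
Proof.
move=> ab cf fa fb.
have [||c cab fc] := @IVT R f a b 0 ab.
- by apply: continuous_subspaceT => x; apply: cf.
- by rewrite ge_min fa le_max fb orbT.
by exists c => //; move: cab; rewrite in_itv.
Qed.

Lemma clamp_continuous (R : realType) (a b : R) :
  continuous (fun x : R => Num.max a (Num.min b x)).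
Proof.
move=> x.
by apply: (@continuous_max R _ (cst a) (cst b \min id) x);
  [exact: cvg_cst | apply: (@continuous_min R _ (cst b) id x);
    [exact: cvg_cst | exact: cvg_id]].
Qed.

Lemma joint_continuous_comp (R : realType) (F : R -> R -> R) (f g : R -> R)
    (x : R) :
  (F z.1 z.2 @[z --> (f x, g x)] --> F (f x) (g x))%classic ->
  {for x, continuous f} -> {for x, continuous g} ->
  {for x, continuous (fun t => F (f t) (g t))}.
Proof. by move=> cF cf cg; exact: (continuous2_cvg _ cF cf cg). Qed.

(** For each [x] the function [E x] has exactly one zero [phi x].
    Monotonicity makes [phi] continuous: the sign of [E x y] tells on which
    side of [phi x] the point [y] lies, and for fixed [y] it persists for
    nearby [x].  The intermediate value theorem for [U x (phi x)] concludes.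
    *)
Lemma common_zero (R : realType) (E U : R -> R -> R) (a b c d : R) :
  a <= b -> c <= d ->
  (forall x y, a <= x <= b -> c <= y <= d ->
    E z.1 z.2 @[z --> (x, y)] --> E x y)%classic ->
  (forall x y, a <= x <= b -> c <= y <= d ->
    U z.1 z.2 @[z --> (x, y)] --> U x y)%classic ->
  (forall x y y', a <= x <= b -> c <= y -> y < y' -> y' <= d ->
    E x y < E x y') ->
  (forall x, a <= x <= b -> E x c < 0 < E x d) ->
  (forall y, c <= y <= d -> U a y < 0 < U b y) ->
  exists x y, [/\ a <= x <= b, c <= y <= d, E x y = 0 & U x y = 0].
Proof.
move=> ab cd cE cU Emono Eedge Uedge.
(* Composing with the projections onto the sides makes all functions
   continuous on the whole line. *)
pose px x : R := Num.max a (Num.min b x).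
pose py y : R := Num.max c (Num.min d y).
have pxP x : a <= px x <= b by rewrite le_max lexx ge_max ab ge_min lexx.
have pyP y : c <= py y <= d by rewrite le_max lexx ge_max cd ge_min lexx.
have pxE x : a <= x <= b -> px x = x.
  by case/andP => ax xb; rewrite /px (min_r xb) max_r.
have pyE y : c <= y <= d -> py y = y.
  by case/andP => cy yd; rewrite /py (min_r yd) max_r.
have pxc : continuous px by move=> x; apply: clamp_continuous.
have pyc : continuous py by move=> y; apply: clamp_continuous.
have root x : exists y, (c <= y <= d) && (E (px x) y == 0).
  have [|||y yP Ey] := @IVT_le_ge R (fun y => E (px x) (py y)) c d cd.
  - move=> y; apply: (joint_continuous_comp (f := cst _) (cE _ _ (pxP x) (pyP y))).
      exact: cvg_cst.
    exact: pyc.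
  - by rewrite pyE ?lexx //; have /andP[/ltW] := Eedge _ (pxP x).
  - by rewrite pyE ?lexx ?andbT //; have /andP[_ /ltW] := Eedge _ (pxP x).
  by exists y; rewrite yP -Ey pyE // eqxx.
pose phi x := xchoose (root x).
have phiP x : c <= phi x <= d by have /andP[] := xchooseP (root x).
have phi0 x : E (px x) (phi x) = 0 by have /andP[_ /eqP] := xchooseP (root x).
have below x y : c <= y <= d -> E (px x) y < 0 -> y < phi x.
  move=> /andP[cy yd] Ey; rewrite ltNge le_eqVlt; apply/negP => /orP[/eqP e|yx].
    by move: Ey; rewrite -e phi0 ltxx.
  have /andP[cphi _] := phiP x.
  by have := lt_trans (Emono _ _ _ (pxP x) cphi yx yd) Ey; rewrite phi0 ltxx.
have above x y : c <= y <= d -> 0 < E (px x) y -> phi x < y.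
  move=> /andP[cy yd] Ey; rewrite ltNge le_eqVlt; apply/negP => /orP[/eqP e|yx].
    by move: Ey; rewrite e phi0 ltxx.
  have /andP[_ phid] := phiP x.
  by have := lt_trans Ey (Emono _ _ _ (pxP x) cy yx phid); rewrite phi0 ltxx.
have cEx x y : c <= y <= d -> {for x, continuous (fun x => E (px x) y)}.
  move=> yP; apply: (joint_continuous_comp (g := cst y) (cE _ _ (pxP x) yP)).
    exact: pxc.
  exact: cvg_cst.
have phic : continuous phi.
  move=> x; apply/cvgrPdist_lt => e e0; have /andP[cx xd] := phiP x.
  have lo : \forall t \near x, phi x - e < phi t.
    have [ce|ec] := leP c (phi x - e); last first.
      by near=> t; apply: lt_le_trans ec _; have /andP[] := phiP t.
    have eP : c <= phi x - e <= d by rewrite ce /=; lra.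
    have : E (px x) (phi x - e) < 0.
      by rewrite -(phi0 x); apply: Emono => //; lra.
    move=> /(cvgr_lt _ (cEx x _ eP)); apply: filterS => t; exact: below.
  have hi : \forall t \near x, phi t < phi x + e.
    have [ce|ec] := leP (phi x + e) d; last first.
      by near=> t; apply: le_lt_trans ec; have /andP[] := phiP t.
    have eP : c <= phi x + e <= d by rewrite ce andbT; lra.
    have : 0 < E (px x) (phi x + e).
      by rewrite -(phi0 x); apply: Emono => //; lra.
    move=> /(cvgr_gt _ (cEx x _ eP)); apply: filterS => t; exact: above.
  near=> t; rewrite ltr_distlC; apply/andP; split.
    by near: t.
  by near: t.
have [|||x xP Ux] := @IVT_le_ge R (fun x => U (px x) (phi x)) a b ab.
- move=> x; apply: (joint_continuous_comp (cU _ _ (pxP x) (phiP x))); first exact: pxc.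
  exact: phic.
- by rewrite pxE ?lexx //; have /andP[/ltW] := Uedge _ (phiP a).
- by rewrite pxE ?lexx ?andbT //; have /andP[_ /ltW] := Uedge _ (phiP b).
exists x, (phi x); split => //; first by have := phi0 x; rewrite pxE.
by move: Ux; rewrite pxE.
Unshelve. all: by end_near. Qed.

(** * Certified fixed-point interval arithmetic *)

Definition fbits : Z := Zpos 54.

Definition funit : Z := Z.pow 2 fbits.

(** The interval [Some (lo, hi)] has the endpoints [lo / funit] and [hi /
    funit]; [None] is the whole line and stands for the result of an operation
    outside its domain, which makes every operation total and sound without
    side conditions. *)
Definition ival : Type := option (Z * Z).

(** Locked, since unfolding it on a large integer reaches unary numbers. *)
HB.lock Definition zr (R : realType) (z : Z) : R := (int_of_Z z)%:~R.

Definition encl (R : realType) (I : ival) (x : R) : Prop :=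
  if I is Some (lo, hi) then zr R lo <= x * zr R funit <= zr R hi else True.

Definition zfloor (z : Z) : Z := Z.shiftr z fbits.

Definition zceil (z : Z) : Z := Z.opp (Z.shiftr (Z.opp z) fbits).

Definition addI (I J : ival) : ival :=
  if (I, J) is (Some (a, b), Some (c, d)) then Some (Z.add a c, Z.add b d)
  else None.

Definition oppI (I : ival) : ival :=
  if I is Some (a, b) then Some (Z.opp b, Z.opp a) else None.

Definition mulI (I J : ival) : ival :=
  if (I, J) is (Some (a, b), Some (c, d)) then
    let p := Z.mul a c in let q := Z.mul a d in
    let r := Z.mul b c in let s := Z.mul b d in
    Some (zfloor (Z.min (Z.min p q) (Z.min r s)),
          zceil (Z.max (Z.max p q) (Z.max r s)))
  else None.

Definition invI (I : ival) : ival :=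
  if I is Some (a, b) then
    if Z.ltb 0 a then
      let u := Z.mul funit funit in
      Some (Z.div u b, Z.opp (Z.div (Z.opp u) a))
    else None
  else None.

Definition divI (I J : ival) : ival := mulI I (invI J).

Definition sqrtI (I : ival) : ival :=
  if I is Some (a, b) then
    if Z.leb 0 a then
      Some (Z.sqrt (Z.mul a funit), Z.succ (Z.sqrt (Z.mul b funit)))
    else None
  else None.

Definition ratI (n d : Z) : ival :=
  if Z.ltb 0 d then
    Some (Z.div (Z.mul n funit) d, Z.opp (Z.div (Z.opp (Z.mul n funit)) d))
  else None.

(** From the lower end of one interval to the upper end of another one. *)
Definition hullI (I J : ival) : ival :=
  if (I, J) is (Some (a, _), Some (_, d)) then Some (a, d) else None.

(** After [n] square roots the argument [y] is close to one, where [1 - 1 / y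
    <= ln y <= y - 1] is sharp; each square root is undone by a doubling. *)
Fixpoint lnI (n : nat) (I : ival) : ival :=
  if n is n'.+1 then let J := lnI n' (sqrtI I) in addI J J
  else hullI (addI (ratI 1 1) (oppI (invI I))) (addI I (oppI (ratI 1 1))).

(** After [n] halvings the argument [x] is close to zero, where [1 + x <= expR
    x <= 1 / (1 - x)] is sharp; each halving is undone by a squaring. *)
Fixpoint expI (n : nat) (I : ival) : ival :=
  if n is n'.+1 then
    let J := expI n' (mulI I (ratI 1 2)) in mulI J J
  else hullI (addI (ratI 1 1) I) (invI (addI (ratI 1 1) (oppI I))).

Lemma zrD (R : realType) (x y : Z) : zr R (Z.add x y) = zr R x + zr R y.
Proof. by rewrite zr.unlock -(rmorphD intr) -(rmorphD int_of_Z). Qed.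

Lemma zrN (R : realType) (x : Z) : zr R (Z.opp x) = - zr R x.
Proof. by rewrite zr.unlock -(rmorphN intr) -(rmorphN int_of_Z). Qed.

Lemma zrM (R : realType) (x y : Z) : zr R (Z.mul x y) = zr R x * zr R y.
Proof. by rewrite zr.unlock -(rmorphM intr) -(rmorphM int_of_Z). Qed.

Lemma ler_zr (R : realType) (x y : Z) : Z.le x y -> zr R x <= zr R y.
Proof. by move=> h; rewrite zr.unlock ler_int; lia. Qed.

Lemma ltr_zr (R : realType) (x y : Z) : Z.lt x y -> zr R x < zr R y.
Proof. by move=> h; rewrite zr.unlock ltr_int; lia. Qed.

Lemma zr0 (R : realType) : zr R 0 = 0.
Proof. by rewrite zr.unlock. Qed.

Lemma zr1 (R : realType) : zr R 1 = 1.
Proof. by rewrite zr.unlock. Qed.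

Lemma zr2 (R : realType) : zr R 2 = 2.
Proof. by rewrite zr.unlock. Qed.

Lemma funitE (z : Z) : Z.shiftr z fbits = Z.div z funit.
Proof. by rewrite Z.shiftr_div_pow2. Qed.

Lemma funit_pos : Z.lt 0 funit.
Proof. exact: Z.pow_pos_nonneg. Qed.

(* Simplification would otherwise expand the power of two. *)
Local Opaque funit.

Lemma funit_gt0 (R : realType) : 0 < zr R funit.
Proof. by rewrite -(zr0 R); apply: ltr_zr; exact: funit_pos. Qed.

Lemma zfloor_le (R : realType) (z : Z) : zr R (zfloor z) * zr R funit <= zr R z.
Proof.
rewrite -zrM; apply: ler_zr; rewrite /zfloor funitE.
rewrite Z.mul_comm; exact: Z.mul_div_le funit_pos.
Qed.

Lemma zceil_ge (R : realType) (z : Z) : zr R z <= zr R (zceil z) * zr R funit.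
Proof.
have := zfloor_le R (Z.opp z).
by rewrite /zceil /zfloor !zrN mulNr lerNr.
Qed.

Lemma encl_add (R : realType) I J (x y : R) :
  encl I x -> encl J y -> encl (addI I J) (x + y).
Proof.
case: I J => [[a b]|] [[c d]|] //= /andP[h1 h2] /andP[h3 h4].
by rewrite !zrD mulrDl !lerD.
Qed.

Lemma encl_opp (R : realType) I (x : R) : encl I x -> encl (oppI I) (- x).
Proof. by case: I => [[a b]|] //=; rewrite !zrN mulNr !lerN2 andbC. Qed.

(** A bilinear function on a rectangle lies between its extreme values at the
    corners. *)
Lemma mul_between (R : realType) (a b c d x y lo hi : R) :
  a <= x <= b -> c <= y <= d ->
  lo <= a * c -> lo <= a * d -> lo <= b * c -> lo <= b * d ->
  a * c <= hi -> a * d <= hi -> b * c <= hi -> b * d <= hi ->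
  lo <= x * y <= hi.
Proof.
move=> /andP[ax xb] /andP[cy yd] l1 l2 l3 l4 h1 h2 h3 h4.
case: (leP 0 y) => y0.
  have k1 : a * y <= x * y by rewrite ler_wpM2r.
  have k2 : x * y <= b * y by rewrite ler_wpM2r.
  by case: (leP 0 a) => a0; case: (leP 0 b) => b0; apply/andP; split; nra.
have k1 : b * y <= x * y by nra.
have k2 : x * y <= a * y by nra.
by case: (leP 0 a) => a0; case: (leP 0 b) => b0; apply/andP; split; nra.
Qed.

Lemma encl_mul (R : realType) I J (x y : R) :
  encl I x -> encl J y -> encl (mulI I J) (x * y).
Proof.
case: I J => [[a b]|] [[c d]|] //= hx hy.
have u0 := funit_gt0 R.
set lo := Z.min _ _; set hi := Z.max _ _.
have /andP[h1 h2] : zr R lo <= (x * zr R funit) * (y * zr R funit) <= zr R hi.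
  by apply: (mul_between hx hy); rewrite -zrM; apply: ler_zr;
    rewrite /lo /hi; lia.
have E : (x * zr R funit) * (y * zr R funit) = x * y * zr R funit * zr R funit.
  by move: (zr R funit) => u; ring.
rewrite E in h1 h2.
apply/andP; split; rewrite -(ler_pM2r u0).
  exact: le_trans (zfloor_le R lo) h1.
exact: le_trans h2 (zceil_ge R hi).
Qed.

Lemma encl_inv (R : realType) I (x : R) : encl I x -> encl (invI I) x^-1.
Proof.
case: I => [[a b]|] //= /andP[h1 h2]; case: Z.ltb_spec => //= a0.
have u0 := funit_gt0 R; have := funit_pos; move: funit u0 h1 h2 => u u0 h1 h2 uZ.
have a0' : 0 < zr R a by rewrite -(zr0 R); apply: ltr_zr.
have y0 : 0 < x * zr R u := lt_le_trans a0' h1.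
have b0' : 0 < zr R b := lt_le_trans y0 h2.
have x0 : 0 < x by rewrite pmulr_lgt0 in y0.
have b0 : Z.lt 0 b.
  case: (Z.lt_ge_cases 0 b) => // h; move/(ler_zr R): h.
  by rewrite zr0 leNgt b0'.
have k1 : zr R (Z.div (Z.mul u u) b) * zr R b <= zr R u * zr R u.
  by rewrite -!zrM; apply: ler_zr; rewrite Z.mul_comm; apply: Z.mul_div_le.
have k2 : zr R u * zr R u
    <= zr R (Z.opp (Z.div (Z.opp (Z.mul u u)) a)) * zr R a.
  rewrite -!zrM; apply: ler_zr.
  have := Z.mul_div_le (Z.opp (Z.mul u u)) a a0; lia.
have k3 : 0 <= zr R (Z.div (Z.mul u u) b).
  by rewrite -(zr0 R); apply: ler_zr; apply: Z.div_pos b0; nia.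
have k4 : 0 <= zr R (Z.opp (Z.div (Z.opp (Z.mul u u)) a)).
  rewrite zrN oppr_ge0 -(zr0 R); apply: ler_zr.
  by apply: Z.div_le_upper_bound a0 _; nia.
have -> : x^-1 * zr R u = zr R u * zr R u / (x * zr R u).
  by field; rewrite !gt_eqF.
apply/andP; split.
  by rewrite ler_pdivlMr //; apply: le_trans k1; apply: ler_wpM2l h2.
by rewrite ler_pdivrMr //; apply: le_trans k2 _; apply: ler_wpM2l h1.
Qed.

Lemma encl_div (R : realType) I J (x y : R) :
  encl I x -> encl J y -> encl (divI I J) (x / y).
Proof. by move=> hx hy; apply: encl_mul hx (encl_inv hy). Qed.

Lemma encl_sqrt (R : realType) I (x : R) :
  encl I x -> encl (sqrtI I) (Num.sqrt x).
Proof.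
case: I => [[a b]|] //= /andP[h1 h2]; case: Z.leb_spec => //= a0.
have u0 := funit_gt0 R; have := funit_pos; move: funit u0 h1 h2 => u u0 h1 h2 uZ.
have a0' : 0 <= zr R a by rewrite -(zr0 R); apply: ler_zr.
have x0 : 0 <= x by rewrite -(pmulr_lge0 _ u0); apply: le_trans h1.
have b0 : Z.le 0 b.
  case: (Z.le_gt_cases 0 b) => // h; move/(ltr_zr R): h.
  by rewrite zr0 ltNge (le_trans _ h2) // mulr_ge0 // ltW.
have s0 : 0 <= Num.sqrt x * zr R u by rewrite mulr_ge0 ?sqrtr_ge0 // ltW.
have E : (Num.sqrt x * zr R u) ^+ 2 = x * zr R u * zr R u.
  by rewrite exprMn sqr_sqrtr // expr2 mulrA.
have [q1 _] := Z.sqrt_spec (Z.mul a u) ltac:(nia).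
have [_ q2] := Z.sqrt_spec (Z.mul b u) ltac:(nia).
apply/andP; split.
  rewrite -ler_sqr ?nnegrE //; last first.
    by rewrite -(zr0 R); apply: ler_zr; apply: Z.sqrt_nonneg.
  rewrite E; apply: le_trans (_ : zr R a * zr R u <= _); last first.
    by rewrite ler_pM2r.
  by rewrite expr2 -!zrM; apply: ler_zr.
rewrite -ler_sqr ?nnegrE //; last first.
  by rewrite -(zr0 R); apply: ler_zr; have := Z.sqrt_nonneg (Z.mul b u); lia.
rewrite E; apply: le_trans (_ : zr R b * zr R u <= _).
  by rewrite ler_pM2r.
by rewrite expr2 -!zrM; apply: ler_zr; lia.
Qed.

Lemma encl_rat (R : realType) (n d : Z) : encl (ratI n d) (zr R n / zr R d).
Proof.
rewrite /ratI; case: Z.ltb_spec => //= d0.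
have u0 := funit_gt0 R; move: funit u0 => u u0.
have d0' : 0 < zr R d by rewrite -(zr0 R); apply: ltr_zr.
rewrite mulrAC -zrM; apply/andP; split.
  rewrite ler_pdivlMr // -zrM; apply: ler_zr; rewrite Z.mul_comm.
  by apply: Z.mul_div_le.
rewrite ler_pdivrMr // -zrM; apply: ler_zr.
have := Z.mul_div_le (Z.opp (Z.mul n u)) d d0; lia.
Qed.

Lemma encl_one (R : realType) : encl (ratI 1 1) (1 : R).
Proof.
have -> : (1 : R) = zr R 1 / zr R 1 by rewrite zr1 divr1.
exact: encl_rat.
Qed.

(** Used where [1 <= x] makes the upper bound [1 / (1 - x)] for [expR x]
    meaningless: the interval for it is then the whole line. *)
Lemma invI_None (R : realType) I (x : R) : x <= 0 -> encl I x -> invI I = None.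
Proof.
have u0 := funit_gt0 R; move=> x_le0.
case: I => [[a b]|] //= /andP[h _]; case: Z.ltb_spec => // a0.
suff : zr R a <= zr R 0 by rewrite leNgt (ltr_zr R a0).
by rewrite zr0; apply: le_trans h _; rewrite mulr_le0_ge0 // ltW.
Qed.

Lemma encl_hull (R : realType) I J (x y z : R) :
  encl I x -> encl J z -> x <= y <= z -> encl (hullI I J) y.
Proof.
have u0 := funit_gt0 R.
case: I J => [[a b]|] [[c d]|] //= /andP[h1 _] /andP[_ h2] /andP[xy yz].
apply/andP; split; first by apply: (le_trans h1); rewrite ler_pM2r.
by apply: le_trans h2; rewrite ler_pM2r.
Qed.

Lemma encl_ln (R : realType) n I (x : R) : 0 < x -> encl I x ->
  encl (lnI n I) (ln x).
Proof.
elim: n I x => [|n IH] I x x0 hx.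
  rewrite /lnI; apply: (encl_hull (encl_add (encl_one R) (encl_opp (encl_inv hx)))
    (encl_add hx (encl_opp (encl_one R)))).
  apply/andP; split.
    have := le_ln1Dx (x := x^-1 - 1).
    rewrite subrKC lnV // ?ltrBrDl ?subrr ?invr_gt0 // => /(_ _).
    by rewrite ?invr_gt0 //; lra.
  by have := le_ln1Dx (x := x - 1); rewrite subrKC; apply; lra.
have s0 : 0 < Num.sqrt x by rewrite sqrtr_gt0.
have -> : ln x = ln (Num.sqrt x) + ln (Num.sqrt x).
  by rewrite -lnM ?posrE // -expr2 sqr_sqrtr // ltW.
by have h := IH _ _ s0 (encl_sqrt hx); apply: encl_add.
Qed.

Lemma encl_exp (R : realType) n I (x : R) : encl I x -> encl (expI n I) (expR x).
Proof.
elim: n I x => [|n IH] I x hx.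
  rewrite /expI.
  have hi := encl_inv (encl_add (encl_one R) (encl_opp hx)).
  case: (ltP x 1) => x1.
    apply: (encl_hull (encl_add (encl_one R) hx) hi); rewrite expR_ge1Dx /=.
    rewrite -[expR x]invrK -expRN.
    by rewrite lef_pV2 ?posrE ?expR_gt0 ?expR_ge1Dx // subr_gt0.
  rewrite /hullI (invI_None _ (encl_add (encl_one R) (encl_opp hx))) ?subr_le0 //.
  by case: (addI _ _) => [[]|].
have -> : expR x = expR (x * (zr R 1 / zr R 2)) * expR (x * (zr R 1 / zr R 2)).
  by rewrite -expRD; congr expR; rewrite zr1 zr2; lra.
by have h := IH _ _ (encl_mul hx (encl_rat R 1 2)); apply: encl_mul.
Qed.

(** * Signs on the boundary of the rectangle *)

Arguments encl : simpl never.
Arguments addI : simpl never.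
Arguments oppI : simpl never.
Arguments mulI : simpl never.
Arguments divI : simpl never.
Arguments sqrtI : simpl never.
Arguments ratI : simpl never.
Arguments lnI : simpl never.
Arguments expI : simpl never.

Definition encl3 (R : realType) (I : ival * ival * ival)
    (x : R * R * R) : Prop :=
  [/\ encl I.1.1 x.1.1, encl I.1.2 x.1.2 & encl I.2 x.2].

(** The coordinates of [B X B], as in [smx_conj]. *)
Definition conj3 (R : realType) (B X : R * R * R) : R * R * R :=
  (X.1.1 * (B.1.1 ^+ 2 + (B.1.2 ^+ 2 + B.2 ^+ 2))
     + 2 * B.1.1 * (B.1.2 * X.1.2 + B.2 * X.2),
   2 * (B.1.1 * X.1.1 + (B.1.2 * X.1.2 + B.2 * X.2)) * B.1.2
     + (B.1.1 ^+ 2 - (B.1.2 ^+ 2 + B.2 ^+ 2)) * X.1.2,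
   2 * (B.1.1 * X.1.1 + (B.1.2 * X.1.2 + B.2 * X.2)) * B.2
     + (B.1.1 ^+ 2 - (B.1.2 ^+ 2 + B.2 ^+ 2)) * X.2).

(** The coordinates of the exponential of [smx 0 p q], where [d ^+ 2 = p ^+ 2
    + q ^+ 2], as in [smx0_exp]. *)
Definition exp3 (R : realType) (d p q : R) : R * R * R :=
  ((expR d + expR (- d)) / 2, (expR d - expR (- d)) / 2 / d * p,
   (expR d - expR (- d)) / 2 / d * q).

(** The positive eigenvalue of [Z3]. *)
Definition rho (R : realType) : R := Num.sqrt (3 ^+ 2 + (19 / 10) ^+ 2).

(** The coordinates of [X0], which is also [B1]; those of [B2], [B3] and of
    [A1], [A2], [A3] follow. *)
Definition Xpt (R : realType) : R * R * R := exp3 3 3 0.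
Definition Bpt2 (R : realType) : R * R * R := exp3 (19 / 10) 0 (19 / 10).
Definition Bpt3 (R : realType) : R * R * R := exp3 (rho R) (- 3) (- 19 / 10).
Definition Apt1 (R : realType) := conj3 (Xpt R) (Xpt R).
Definition Apt2 (R : realType) := conj3 (Bpt2 R) (Xpt R).
Definition Apt3 (R : realType) := conj3 (Bpt3 R) (Xpt R).

Definition weight3 (R : realType) (c : R * R * R) (P Q : R) : R :=
  weight c.1.1 c.1.2 c.2 P Q.

(** If the first point has [b = 0] then [(p1 + P, Q)] is the direction of the
    first logarithm, and this is its cross product with [(F, G)], the sum of
    the three vectors [weight3 c P Q * (p + P, b + Q)].  The cross products
    [(p1 + P) (b + Q) - Q (p + P)] are written as [(p1 + P) b + Q (p1 - p)],
    an affine function of [Q]. *)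
Definition crossF (R : realType) (c1 c2 c3 : R * R * R) (P Q : R) : R :=
  ((c1.1.2 + P) * c2.2 + Q * (c1.1.2 - c2.1.2)) * weight3 c2 P Q
  + ((c1.1.2 + P) * c3.2 + Q * (c1.1.2 - c3.1.2)) * weight3 c3 P Q.

(** The difference [F - G] of the two coordinates.  Its partial derivative in
    [Q] is small near the second solution, which keeps its sign constant along
    each of the vertical edges. *)
Definition diffF (R : realType) (c1 c2 c3 : R * R * R) (P Q : R) : R :=
  ((c1.1.2 + P) - (c1.2 + Q)) * weight3 c1 P Q
  + ((c2.1.2 + P) - (c2.2 + Q)) * weight3 c2 P Q
  + ((c3.1.2 + P) - (c3.2 + Q)) * weight3 c3 P Q.

Definition sqI (I : ival) := mulI I I.

Definition subI (I J : ival) := addI I (oppI J).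

Definition conj3I (B X : ival * ival * ival) :=
  (addI (mulI X.1.1 (addI (sqI B.1.1) (addI (sqI B.1.2) (sqI B.2))))
     (mulI (mulI (ratI 2 1) B.1.1) (addI (mulI B.1.2 X.1.2) (mulI B.2 X.2))),
   addI
     (mulI (mulI (ratI 2 1) (addI (mulI B.1.1 X.1.1)
        (addI (mulI B.1.2 X.1.2) (mulI B.2 X.2)))) B.1.2)
     (mulI (subI (sqI B.1.1) (addI (sqI B.1.2) (sqI B.2))) X.1.2),
   addI
     (mulI (mulI (ratI 2 1) (addI (mulI B.1.1 X.1.1)
        (addI (mulI B.1.2 X.1.2) (mulI B.2 X.2)))) B.2)
     (mulI (subI (sqI B.1.1) (addI (sqI B.1.2) (sqI B.2))) X.2)).

(** With 26 halvings the relative error of the exponentials is below [10 ^-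
    6]. *)
Definition exp3I (d p q : ival) :=
  (divI (addI (expI 26 d) (expI 26 (oppI d))) (ratI 2 1),
   mulI (divI (divI (subI (expI 26 d) (expI 26 (oppI d))) (ratI 2 1)) d) p,
   mulI (divI (divI (subI (expI 26 d) (expI 26 (oppI d))) (ratI 2 1)) d) q).

Definition XptI := exp3I (ratI 3 1) (ratI 3 1) (ratI 0 1).
Definition Bpt2I := exp3I (ratI 19 10) (ratI 0 1) (ratI 19 10).
Definition Bpt3I :=
  exp3I (sqrtI (addI (sqI (ratI 3 1)) (sqI (ratI 19 10))))
    (ratI (-3) 1) (ratI (-19) 10).
Definition Apt1I := Eval vm_compute in conj3I XptI XptI.
Definition Apt2I := Eval vm_compute in conj3I Bpt2I XptI.
Definition Apt3I := Eval vm_compute in conj3I Bpt3I XptI.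

Definition hgtI (P Q : ival) :=
  sqrtI (addI (ratI 1 1) (addI (sqI P) (sqI Q))).

Definition hdetI (c : ival * ival * ival)
    (P Q : ival) :=
  mulI (ratI 2 1)
    (subI (subI (addI (ratI 1 1) (mulI c.1.1 (hgtI P Q))) (mulI c.1.2 P))
      (mulI c.2 Q)).

Definition gapI (c : ival * ival * ival)
    (P Q : ival) :=
  sqrtI (addI (sqI (addI c.1.2 P)) (sqI (addI c.2 Q))).

Definition weightI (c : ival * ival * ival)
    (P Q : ival) :=
  divI (lnI 15 (divI (addI (addI c.1.1 (hgtI P Q)) (gapI c P Q))
                 (sqrtI (hdetI c P Q)))) (gapI c P Q).

Definition crossFI (c1 c2 c3 : ival * ival * ival)
    (P Q : ival) :=
  addI
    (mulI (addI (mulI (addI c1.1.2 P) c2.2) (mulI Q (subI c1.1.2 c2.1.2)))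
      (weightI c2 P Q))
    (mulI (addI (mulI (addI c1.1.2 P) c3.2) (mulI Q (subI c1.1.2 c3.1.2)))
      (weightI c3 P Q)).

Definition diffFI (c1 c2 c3 : ival * ival * ival)
    (P Q : ival) :=
  addI (addI (mulI (subI (addI c1.1.2 P) (addI c1.2 Q)) (weightI c1 P Q))
         (mulI (subI (addI c2.1.2 P) (addI c2.2 Q)) (weightI c2 P Q)))
    (mulI (subI (addI c3.1.2 P) (addI c3.2 Q)) (weightI c3 P Q)).

Arguments weightI : simpl never.
Arguments crossFI : simpl never.
Arguments diffFI : simpl never.

Definition negI (I : ival) : bool :=
  if I is Some (_, b) then Z.ltb b 0 else false.

Definition posI (I : ival) : bool :=
  if I is Some (a, _) then Z.ltb 0 a else false.

(** Checks [f] on [n] adjacent intervals of length [step] that start at [lo].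
    *)
Fixpoint cover (f : ival -> bool) (lo step : Z) (n : nat) : bool :=
  if n is n'.+1 then
    f (Some (lo, Z.add lo step)) && cover f (Z.add lo step) step n'
  else true.

Definition hyperb (R : realType) (x : R * R * R) : Prop :=
  0 < x.1.1 /\ x.1.1 ^+ 2 - (x.1.2 ^+ 2 + x.2 ^+ 2) = 1.

Lemma encl_sq (R : realType) I (x : R) : encl I x -> encl (sqI I) (x ^+ 2).
Proof. by move=> h; rewrite expr2; apply: encl_mul. Qed.

Lemma encl_sub (R : realType) I J (x y : R) :
  encl I x -> encl J y -> encl (subI I J) (x - y).
Proof. by move=> h k; apply: encl_add h (encl_opp k). Qed.

Lemma encl_ratE (R : realType) (n d : Z) (x : R) :
  zr R n / zr R d = x -> encl (ratI n d) x.
Proof. by move=> <-; apply: encl_rat. Qed.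

Lemma encl_two (R : realType) : encl (ratI 2 1) (2 : R).
Proof. by apply: encl_ratE; rewrite zr1 zr2 divr1. Qed.

Lemma encl_hgt (R : realType) I J (P Q : R) :
  encl I P -> encl J Q -> encl (hgtI I J) (hgt P Q).
Proof.
move=> hP hQ; apply: encl_sqrt; apply: (encl_add (encl_one R)).
by apply: encl_add; apply: encl_sq.
Qed.

(** Follows the structure of the interval expression.  Matching on its head
    symbol keeps the unifier from evaluating interval operations. *)
Ltac encl :=
  repeat match goal with
  | |- encl (ratI 1 1) _ => exact: encl_one
  | |- encl (ratI 2 1) _ => exact: encl_two
  | |- encl (sqI _) _ => apply: encl_sq
  | |- encl (subI _ _) _ => apply: encl_sub
  | |- encl (addI _ _) _ => apply: encl_add
  | |- encl (mulI _ _) _ => apply: encl_mul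
  | |- encl (divI _ _) _ => apply: encl_div
  | |- encl (oppI _) _ => apply: encl_opp
  | |- encl (sqrtI _) _ => apply: encl_sqrt
  | |- encl (expI _ _) _ => apply: encl_exp
  | |- encl (hgtI _ _) _ => apply: encl_hgt
  | |- encl ?I _ => eassumption
  end.

(** Only the argument of the logarithm needs to be known positive beforehand;
    the domain conditions of the other operations are checked by the interval
    operations. *)
Lemma encl_weight (R : realType) C I J (c : R * R * R) (P Q : R) :
  hyperb c -> encl3 C c -> encl I P -> encl J Q ->
  encl (weightI C I J) (weight3 c P Q).
Proof.
move=> [a0 aD] [ha hp hb] hP hQ.
have hd : encl (hdetI C I J) (hdet c.1.1 c.1.2 c.2 P Q).
  by rewrite /hdetI /hdet; encl.
have hg : encl (gapI C I J) (gap c.1.2 c.2 P Q) by rewrite /gapI /gap; encl.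
have pos : 0 < (c.1.1 + hgt P Q + gap c.1.2 c.2 P Q)
    / Num.sqrt (hdet c.1.1 c.1.2 c.2 P Q).
  rewrite divr_gt0 ?sqrtr_gt0 ?hdet_gt0 //.
  by rewrite ltr_wpDr ?sqrtr_ge0 // addr_gt0 // hgt_gt0.
refine (encl_div (encl_ln 15 pos _) hg); encl.
Qed.

Lemma encl_crossF (R : realType) C1 C2 C3 I J (c1 c2 c3 : R * R * R) (P Q : R) :
  hyperb c2 -> hyperb c3 ->
  encl3 C1 c1 -> encl3 C2 c2 -> encl3 C3 c3 -> encl I P -> encl J Q ->
  encl (crossFI C1 C2 C3 I J) (crossF c1 c2 c3 P Q).
Proof.
move=> h2 h3 k1 k2 k3 hP hQ.
have w2 := encl_weight h2 k2 hP hQ; have w3 := encl_weight h3 k3 hP hQ.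
by case: k1 k2 k3 => ? ? ? [? ? ?] [? ? ?]; rewrite /crossFI /crossF; encl.
Qed.

Lemma encl_diffF (R : realType) C1 C2 C3 I J (c1 c2 c3 : R * R * R) (P Q : R) :
  hyperb c1 -> hyperb c2 -> hyperb c3 ->
  encl3 C1 c1 -> encl3 C2 c2 -> encl3 C3 c3 -> encl I P -> encl J Q ->
  encl (diffFI C1 C2 C3 I J) (diffF c1 c2 c3 P Q).
Proof.
move=> h1 h2 h3 k1 k2 k3 hP hQ; have w1 := encl_weight h1 k1 hP hQ.
have w2 := encl_weight h2 k2 hP hQ; have w3 := encl_weight h3 k3 hP hQ.
by case: k1 k2 k3 => ? ? ? [? ? ?] [? ? ?]; rewrite /diffFI /diffF; encl.
Qed.

Lemma negIP (R : realType) I (x : R) : negI I -> encl I x -> x < 0.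
Proof.
rewrite /encl; case: I => [[a b]|] //= /Z.ltb_spec0 b0 /andP[_ h].
rewrite -(pmulr_llt0 _ (funit_gt0 R)); apply: le_lt_trans h _.
by rewrite -(zr0 R); apply: ltr_zr.
Qed.

Lemma posIP (R : realType) I (x : R) : posI I -> encl I x -> 0 < x.
Proof.
rewrite /encl; case: I => [[a b]|] //= /Z.ltb_spec0 a0 /andP[h _].
rewrite -(pmulr_lgt0 _ (funit_gt0 R)); apply: lt_le_trans _ h.
by rewrite -(zr0 R); apply: ltr_zr.
Qed.

Lemma coverP (R : realType) f lo step n (x : R) :
  Z.le 0 step -> (0 < n)%N -> cover f lo step n ->
  zr R lo <= x * zr R funit <= zr R (Z.add lo (Z.mul (Z.of_nat n) step)) ->
  exists2 I, f I & encl I x.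
Proof.
move=> step0; elim: n lo => // n IH lo _; rewrite [cover _ _ _ _]/=.
move=> /andP[fI fn] /andP[lox xhi].
have [xm|mx] := leP (x * zr R funit) (zr R (Z.add lo step)).
  by exists (Some (lo, Z.add lo step)); rewrite // /encl lox xm.
case: n IH fn xhi => [_ _ xhi|n IH fn xhi].
  move: (lt_le_trans mx xhi); rewrite ltNge => /negP[]; apply: ler_zr; lia.
apply: (IH (Z.add lo step)) => //; apply/andP; split; first exact: ltW.
by apply: le_trans xhi _; apply: ler_zr; lia.
Qed.

(** The segment from [x / 100] to [y / 100], cut into [n] pieces; the
    successors round the upper end and the length of a piece upwards. *)
Definition cover_hundredths (x y : Z) (n : nat) (f : ival -> bool) : bool :=
  let lo := Z.div (Z.mul x funit) 100 in
  let hi := Z.succ (Z.div (Z.mul y funit) 100) in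
  cover f lo (Z.succ (Z.div (Z.sub hi lo) (Z.of_nat n))) n.

Lemma cover_hundredthsP (R : realType) (a b : Z) n f (x : R) :
  Z.le a b -> (0 < n)%N -> cover_hundredths a b n f ->
  zr R a <= x * zr R 100 <= zr R b -> exists2 I, f I & encl I x.
Proof.
move=> ab n0 cf /andP[ax xb]; apply: (coverP _ n0 cf).
  have := funit_pos; move: funit => u u0.
  have : Z.le (Z.div (Z.mul a u) 100) (Z.div (Z.mul b u) 100).
    by apply: Z.div_le_mono => //; nia.
  move=> h.
  suff : Z.le 0 (Z.div (Z.sub (Z.succ (Z.div (Z.mul b u) 100))
      (Z.div (Z.mul a u) 100)) (Z.of_nat n)) by lia.
  apply: Z.div_pos; lia.
have u0 := funit_gt0 R; have := funit_pos; move: funit u0 => u u0 uZ.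
have c0 : 0 < zr R 100 by rewrite -(zr0 R); apply: ltr_zr.
apply/andP; split.
  rewrite -(ler_pM2r c0) -zrM; apply: le_trans (_ : zr R (Z.mul a u) <= _).
    by apply: ler_zr; rewrite Z.mul_comm; apply: Z.mul_div_le.
  by rewrite zrM mulrAC ler_pM2r.
rewrite -(ler_pM2r c0) -zrM; apply: le_trans (_ : zr R (Z.mul b u) <= _).
  by rewrite zrM mulrAC ler_pM2r.
apply: ler_zr; set lo := Z.div (Z.mul a u) 100.
have h1 := Z.mul_succ_div_gt (Z.mul b u) 100 ltac:(done).
set hi := Z.succ _ in h1 *.
have h2 := Z.mul_succ_div_gt (Z.sub hi lo) (Z.of_nat n) ltac:(lia).
move: (Z.succ _) h2 => w h2; nia.
Qed.

Lemma encl3_conj (R : realType) B X (b x : R * R * R) :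
  encl3 B b -> encl3 X x -> encl3 (conj3I B X) (conj3 b x).
Proof. by case=> ? ? ? [? ? ?]; split; rewrite /conj3I /conj3 /=; encl. Qed.

Lemma encl3_exp (R : realType) D I J (d p q : R) :
  encl D d -> encl I p -> encl J q -> encl3 (exp3I D I J) (exp3 d p q).
Proof. by move=> *; split; rewrite /exp3I /exp3 /=; encl. Qed.

Lemma encl3_X (R : realType) : encl3 XptI (Xpt R).
Proof.
by apply: encl3_exp; apply: encl_ratE; rewrite zr.unlock divr1.
Qed.

Lemma encl3_A1 (R : realType) : encl3 Apt1I (Apt1 R).
Proof.
have -> : Apt1I = conj3I XptI XptI by vm_compute.
by apply: encl3_conj; apply: encl3_X.
Qed.

Lemma encl3_A2 (R : realType) : encl3 Apt2I (Apt2 R).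
Proof.
have -> : Apt2I = conj3I Bpt2I XptI by vm_compute.
apply: (encl3_conj _ (encl3_X R)).
by apply: encl3_exp; apply: encl_ratE; rewrite zr.unlock ?divr1.
Qed.

Lemma encl3_A3 (R : realType) : encl3 Apt3I (Apt3 R).
Proof.
have -> : Apt3I = conj3I Bpt3I XptI by vm_compute.
apply: (encl3_conj _ (encl3_X R)).
apply: encl3_exp; last 2 first.
- by apply: encl_ratE; rewrite zr.unlock divr1.
- by apply: encl_ratE; rewrite zr.unlock.
have h3 : encl (ratI 3 1) (3 : R) by apply: encl_ratE; rewrite zr.unlock divr1.
have hc : encl (ratI 19 10) (19 / 10 : R) by apply: encl_ratE; rewrite zr.unlock.
refine (encl_sqrt (encl_add (encl_sq h3) (encl_sq hc))).
Qed.

Lemma hyperb_exp (R : realType) (d p q : R) : 0 < d -> d ^+ 2 = p ^+ 2 + q ^+ 2 ->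
  hyperb (exp3 d p q).
Proof.
move=> d0 dE; split=> /=; first by rewrite divr_gt0 // addr_gt0 // expR_gt0.
have eE : expR d * expR (- d) = 1 by rewrite -expRD subrr expR0.
move: (expR d) (expR (- d)) eE => x y eE.
have q2 : q ^+ 2 = d ^+ 2 - p ^+ 2 by rewrite dE; ring.
by rewrite -[RHS]eE; field: q2; rewrite gt_eqF.
Qed.

Lemma hyperb_conj (R : realType) (b x : R * R * R) :
  hyperb b -> hyperb x -> hyperb (conj3 b x).
Proof.
by case: b x => [[h p] q] [[a b] c] [/= h0 hD] [/= a0 aD];
  apply: hyperboloid_conj.
Qed.

Lemma sqr_rho (R : realType) : rho R ^+ 2 = 3 ^+ 2 + (19 / 10) ^+ 2.
Proof. by rewrite sqr_sqrtr // addr_ge0 // sqr_ge0. Qed.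

Lemma rho_gt0 (R : realType) : 0 < rho R.
Proof. by rewrite sqrtr_gt0 ltr_pwDl ?sqr_ge0 // exprn_gt0. Qed.

Lemma hyperb_X (R : realType) : hyperb (Xpt R).
Proof. by apply: hyperb_exp => //; ring. Qed.

Lemma hyperb_B2 (R : realType) : hyperb (Bpt2 R).
Proof. by apply: hyperb_exp => //; field. Qed.

Lemma hyperb_B3 (R : realType) : hyperb (Bpt3 R).
Proof. by apply: hyperb_exp; [exact: rho_gt0 | rewrite sqr_rho; field]. Qed.

Lemma hyperb_A1 (R : realType) : hyperb (Apt1 R).
Proof. by apply: hyperb_conj; apply: hyperb_X. Qed.

Lemma hyperb_A2 (R : realType) : hyperb (Apt2 R).
Proof. by apply: (hyperb_conj _ (hyperb_X R)); apply: hyperb_B2. Qed.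

Lemma hyperb_A3 (R : realType) : hyperb (Apt3 R).
Proof. by apply: (hyperb_conj _ (hyperb_X R)); apply: hyperb_B3. Qed.

Lemma hundredths (R : realType) (a b : Z) (x : R) :
  zr R a / 100 <= x <= zr R b / 100 -> zr R a <= x * zr R 100 <= zr R b.
Proof. by rewrite (_ : zr R 100 = 100) ?zr.unlock // => /andP[]; lra. Qed.

(** The rough position of the three points: [A1], [A2] and [A3] have the
    coordinates [(4051.54, 4051.54, 0)], [(225.13, 10.02, 224.91)] and
    [(974.29, -820.21, -525.81)] up to rounding. *)
Lemma A_bounds (R : realType) :
  [/\ 10 < (Apt1 R).1.2, (Apt1 R).2 = 0, 0 < (Apt2 R).1.2 < (Apt1 R).1.2
    & 2 < (Apt2 R).2] /\
  [/\ (Apt3 R).1.2 < 0, (Apt3 R).2 < 0 & (Apt3 R).1.1 <= - 2 * (Apt3 R).2].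
Proof.
have [h11 h12 _] := encl3_A1 R; have [_ h22 h23] := encl3_A2 R.
have [h31 h32 h33] := encl3_A3 R.
have h10 : encl (ratI 10 1) (10 : R) by apply: encl_ratE; rewrite zr.unlock divr1.
split; split.
- by rewrite -subr_gt0; apply: (posIP _ (encl_sub h12 h10)); vm_compute.
- by rewrite /Apt1 /conj3 /Xpt /exp3 /= !mulr0 addr0.
- apply/andP; split; first by apply: (posIP _ h22); vm_compute.
  by rewrite -subr_gt0; apply: (posIP _ (encl_sub h12 h22)); vm_compute.
- by rewrite -subr_gt0; apply: (posIP _ (encl_sub h23 (encl_two R))); vm_compute.
- by apply: (negIP _ h32); vm_compute.
- by apply: (negIP _ h33); vm_compute.
have k := encl_add h31 (encl_mul (encl_two R) h33).
by rewrite mulNr -subr_le0 opprK ltW //; apply: (negIP _ k); vm_compute.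
Qed.

Lemma cover_lt0 (R : realType) (a b : Z) n f (F : R -> R) (x : R) :
  cover_hundredths a b n (fun I => negI (f I)) -> Z.le a b -> (0 < n)%N ->
  (forall I y, encl I y -> encl (f I) (F y)) ->
  zr R a / 100 <= x <= zr R b / 100 -> F x < 0.
Proof.
move=> c ab n0 fF xab.
have [I negF xI] := cover_hundredthsP ab n0 c (hundredths xab).
exact: negIP negF (fF _ _ xI).
Qed.

Lemma cover_gt0 (R : realType) (a b : Z) n f (F : R -> R) (x : R) :
  cover_hundredths a b n (fun I => posI (f I)) -> Z.le a b -> (0 < n)%N ->
  (forall I y, encl I y -> encl (f I) (F y)) ->
  zr R a / 100 <= x <= zr R b / 100 -> 0 < F x.
Proof.
move=> c ab n0 fF xab.
have [I posF xI] := cover_hundredthsP ab n0 c (hundredths xab).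
exact: posIP posF (fF _ _ xI).
Qed.

(** The number of pieces on an edge reflects the distance to zero of the
    function relative to its variation on a piece. *)
Lemma cover_left : cover_hundredths (-105) (-65) 12
  (fun I => negI (diffFI Apt1I Apt2I Apt3I (ratI (-300) 100) I)).
Proof. by vm_compute. Qed.

Lemma cover_right : cover_hundredths (-105) (-65) 8
  (fun I => posI (diffFI Apt1I Apt2I Apt3I (ratI (-200) 100) I)).
Proof. by vm_compute. Qed.

Lemma cover_bottom : cover_hundredths (-300) (-200) 40
  (fun I => negI (crossFI Apt1I Apt2I Apt3I I (ratI (-105) 100))).
Proof. by vm_compute. Qed.

Lemma cover_top : cover_hundredths (-300) (-200) 40
  (fun I => posI (crossFI Apt1I Apt2I Apt3I I (ratI (-65) 100))).
Proof. by vm_compute. Qed.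

Lemma encl_hundredth (R : realType) (n : Z) : encl (ratI n 100) (zr R n / 100).
Proof. by apply: encl_ratE; rewrite (_ : zr R 100 = 100) // zr.unlock. Qed.

Lemma diffF_left_lt0 (R : realType) (Q : R) :
  zr R (-105) / 100 <= Q <= zr R (-65) / 100 ->
  diffF (Apt1 R) (Apt2 R) (Apt3 R) (zr R (-300) / 100) Q < 0.
Proof.
apply: (cover_lt0 cover_left) => [||I y yI]; [lia|lia|].
exact: (encl_diffF (hyperb_A1 R) (hyperb_A2 R) (hyperb_A3 R)
  (encl3_A1 R) (encl3_A2 R) (encl3_A3 R) (encl_hundredth R (-300)) yI).
Qed.

Lemma diffF_right_gt0 (R : realType) (Q : R) :
  zr R (-105) / 100 <= Q <= zr R (-65) / 100 ->
  0 < diffF (Apt1 R) (Apt2 R) (Apt3 R) (zr R (-200) / 100) Q.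
Proof.
apply: (cover_gt0 cover_right) => [||I y yI]; [lia|lia|].
exact: (encl_diffF (hyperb_A1 R) (hyperb_A2 R) (hyperb_A3 R)
  (encl3_A1 R) (encl3_A2 R) (encl3_A3 R) (encl_hundredth R (-200)) yI).
Qed.

Lemma crossF_bottom_lt0 (R : realType) (P : R) :
  zr R (-300) / 100 <= P <= zr R (-200) / 100 ->
  crossF (Apt1 R) (Apt2 R) (Apt3 R) P (zr R (-105) / 100) < 0.
Proof.
apply: (cover_lt0 (F := fun P => crossF _ _ _ P _) cover_bottom) => [||I y yI];
  [lia|lia|].
exact: (encl_crossF (hyperb_A2 R) (hyperb_A3 R)
  (encl3_A1 R) (encl3_A2 R) (encl3_A3 R) yI (encl_hundredth R (-105))).
Qed.

Lemma crossF_top_gt0 (R : realType) (P : R) :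
  zr R (-300) / 100 <= P <= zr R (-200) / 100 ->
  0 < crossF (Apt1 R) (Apt2 R) (Apt3 R) P (zr R (-65) / 100).
Proof.
apply: (cover_gt0 (F := fun P => crossF _ _ _ P _) cover_top) => [||I y yI];
  [lia|lia|].
exact: (encl_crossF (hyperb_A2 R) (hyperb_A3 R)
  (encl3_A1 R) (encl3_A2 R) (encl3_A3 R) yI (encl_hundredth R (-65))).
Qed.

(** * The two solutions *)

Lemma gap_gt0 (R : realType) (p b P Q : R) :
  p + P != 0 \/ b + Q != 0 -> 0 < gap p b P Q.
Proof.
move=> h; rewrite sqrtr_gt0 lt_neqAle addr_ge0 ?sqr_ge0 // andbT eq_sym.
rewrite paddr_eq0 ?sqr_ge0 // !sqrf_eq0 negb_and.
by case: h => ->; rewrite ?orbT.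
Qed.

Lemma cvg_sqr (R : realType) (T : Type) (F : set_system T) (FF : Filter F)
    (f : T -> R) (x : R) :
  (f z @[z --> F] --> x)%classic -> (f z ^+ 2 @[z --> F] --> x ^+ 2)%classic.
Proof.
move=> h; rewrite expr2.
have -> : (fun z => f z ^+ 2) = f \* f by apply/funext => z; rewrite /= expr2.
exact: cvgM.
Qed.

Lemma cvg_sqrt (R : realType) (T : Type) (F : set_system T) (FF : Filter F)
    (f : T -> R) (x : R) :
  (f z @[z --> F] --> x)%classic ->
  (Num.sqrt (f z) @[z --> F] --> Num.sqrt x)%classic.
Proof. by move=> h; apply: (continuous_cvg _ _ h); apply: sqrt_continuous. Qed.

Lemma weight_continuous (R : realType) (a p b P Q : R) : 0 < a ->
  a ^+ 2 - (p ^+ 2 + b ^+ 2) = 1 -> 0 < gap p b P Q ->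
  (weight a p b z.1 z.2 @[z --> (P, Q)] --> weight a p b P Q)%classic.
Proof.
move=> a0 aD d0.
have h0 := hgt_gt0 P Q; have s0 := hdet_gt0 P Q a0 aD.
have c1 : (z.1 @[z --> (P, Q)] --> P)%classic by apply: cvg_fst.
have c2 : (z.2 @[z --> (P, Q)] --> Q)%classic by apply: cvg_snd.
have cc (k : R) : (k @[z --> (P, Q)] --> k)%classic by apply: cvg_cst.
have ch : (hgt z.1 z.2 @[z --> (P, Q)] --> hgt P Q)%classic.
  by apply: cvg_sqrt; apply: cvgD => //; apply: cvgD; apply: cvg_sqr.
have cg : (gap p b z.1 z.2 @[z --> (P, Q)] --> gap p b P Q)%classic.
  by apply: cvg_sqrt; apply: cvgD; apply: cvg_sqr; apply: cvgD.
have cd : (hdet a p b z.1 z.2 @[z --> (P, Q)] --> hdet a p b P Q)%classic.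
  apply: cvgM => //; apply: cvgB; last by apply: cvgM.
  apply: cvgB; last by apply: cvgM.
  by apply: cvgD => //; apply: cvgM.
apply: cvgM; last by apply: cvgV => //; rewrite gt_eqF.
have pos : 0 < (a + hgt P Q + gap p b P Q) / Num.sqrt (hdet a p b P Q).
  by rewrite divr_gt0 ?sqrtr_gt0 // addr_gt0 // addr_gt0.
apply: (continuous_cvg _ (continuous_ln pos)).
apply: cvgM; last by apply: cvgV; [rewrite gt_eqF // sqrtr_gt0|apply: cvg_sqrt].
by apply: cvgD => //; apply: cvgD.
Qed.

(** [crossF] is the sum of an increasing positive term from the second point
    ([weight_incr]) and of minus a decreasing positive term from the third one
    ([weight_scaled_decr]). *)
Lemma crossF_incr (R : realType) (c1 c2 c3 : R * R * R) (P Q Q' : R) :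
  hyperb c2 -> hyperb c3 ->
  0 < gap c2.1.2 c2.2 P Q ->
  0 < gap c3.1.2 c3.2 P Q -> 0 < gap c3.1.2 c3.2 P Q' ->
  10 < c1.1.2 -> 0 < c2.1.2 < c1.1.2 -> 2 < c2.2 ->
  c3.1.2 < 0 -> c3.2 < 0 -> c3.1.1 <= - 2 * c3.2 ->
  - 3 <= P <= - 2 -> - 105 / 100 <= Q -> Q < Q' -> Q' <= 0 ->
  crossF c1 c2 c3 P Q < crossF c1 c2 c3 P Q'.
Proof.
case: c1 c2 c3 => [[a1 p1] b1] [[a2 p2] b2] [[a3 p3] b3] [/= a20 D2] [/= a30 D3].
move=> d2 d3 d3' p1b /andP[p20 p21] b2b p30 b30 ab /andP[P3 P2] Q1 QQ Q0.
rewrite /crossF /weight3 /=; apply: ltrD.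
  have w0 := weight_gt0 a20 D2 d2.
  have wi : weight a2 p2 b2 P Q <= weight a2 p2 b2 P Q'.
    by apply: weight_incr => //; lra.
  apply: lt_le_trans
    (_ : ((p1 + P) * b2 + Q' * (p1 - p2)) * weight a2 p2 b2 P Q <= _).
    rewrite ltr_pM2r // ltrD2l ltr_pM2r //; lra.
  apply: ler_wpM2l wi.
  have k1 : 0 <= (p1 + P) * (b2 - 2) by apply: mulr_ge0; lra.
  have k2 : 0 <= (Q' + 105 / 100) * (p1 - p2) by apply: mulr_ge0; lra.
  lra.
(* Squared, this is [4 * y ^+ 2 <= 1 + P ^+ 2 + y ^+ 2], and [5 <= 1 + P ^+
   2]. *)
have slope y : - 105 / 100 <= y -> y <= 0 -> - 2 * y <= hgt P y.
  move=> y1 y0; apply: le_of_sqr; first by rewrite ltW // hgt_gt0.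
  rewrite sqr_hgt; nra.
(* From [a3 ^+ 2 = 1 + p3 ^+ 2 + b3 ^+ 2]. *)
have ba : - b3 < a3.
  rewrite ltNge; apply/negP => h; have := sqr_ge0 p3; nra.
have := @weight_scaled_decr R a3 p3 b3 P Q Q' (- (p1 + P) * b3) (p1 - p3)
  a30 D3 d3 d3' ab (slope _ Q1 _) (slope _ _ Q0) QQ Q0.
have al0 : 0 < - (p1 + P) * b3 by nra.
have k3 : - (p1 + P) * b3 < (p1 - p3) * a3.
  have k1 : 0 < (p1 + P) * (a3 + b3) by apply: mulr_gt0; lra.
  have k2 : 0 < (- P - p3) * a3 by apply: mulr_gt0; lra.
  lra.
move=> /(_ _ _ al0 k3) k.
have := k ltac:(lra) ltac:(lra); lra.
Qed.

Lemma zr_hundredth (R : realType) (n : nat) :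
  zr R (Z.opp (Z.of_nat n)) / 100 = - n%:R / 100.
Proof.
rewrite zrN; congr (- _ / _); rewrite zr.unlock -[RHS]/((n%:Z)%:~R); congr (_%:~R).
lia.
Qed.

Lemma A_gap_gt0 (R : realType) (P Q : R) :
  - 3 <= P <= - 2 -> - 105 / 100 <= Q <= - 65 / 100 ->
  [/\ 0 < gap (Apt1 R).1.2 (Apt1 R).2 P Q,
      0 < gap (Apt2 R).1.2 (Apt2 R).2 P Q
    & 0 < gap (Apt3 R).1.2 (Apt3 R).2 P Q].
Proof.
move=> /andP[P3 P2] /andP[Q1 Q0]; have [[f1 f2 f3 f4] [f5 f6 f7]] := A_bounds R.
move: (Apt1 R) (Apt2 R) (Apt3 R) f1 f2 f3 f4 f5 f6 f7.
move=> c1 c2 c3 f1 f2 f3 f4 f5 f6 f7.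
split; apply: gap_gt0; [left|right|right].
- by rewrite gt_eqF //; lra.
- by rewrite gt_eqF //; lra.
- by rewrite lt_eqF //; lra.
Qed.

Lemma second_zero (R : realType) : exists P Q : R,
  [/\ - 3 <= P <= - 2, - 105 / 100 <= Q <= - 65 / 100,
    crossF (Apt1 R) (Apt2 R) (Apt3 R) P Q = 0
    & diffF (Apt1 R) (Apt2 R) (Apt3 R) P Q = 0].
Proof.
have [[f1 f2 f3 f4] [f5 f6 f7]] := A_bounds R.
have [h10 h1D] := hyperb_A1 R; have [h20 h2D] := hyperb_A2 R.
have [h30 h3D] := hyperb_A3 R.
have eP : zr R (-300) / 100 = - 3 by rewrite (zr_hundredth R 300); lra.
have eP' : zr R (-200) / 100 = - 2 by rewrite (zr_hundredth R 200); lra.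
have eQ : zr R (-105) / 100 = - 105 / 100 := zr_hundredth R 105.
have eQ' : zr R (-65) / 100 = - 65 / 100 := zr_hundredth R 65.
have := @crossF_top_gt0 R; have := @crossF_bottom_lt0 R.
have := @diffF_right_gt0 R; have := @diffF_left_lt0 R.
rewrite eP eP' eQ eQ' {eP eP' eQ eQ'} => Ul Ur Eb Et.
have := @A_gap_gt0 R.
move: (hyperb_A2 R) (hyperb_A3 R) => hA2 hA3.
move: (Apt1 R) (Apt2 R) (Apt3 R) f1 f2 f3 f4 f5 f6 f7 h10 h1D h20 h2D h30 h3D
  Ul Ur Eb Et hA2 hA3.
move=> c1 c2 c3 f1 f2 f3 f4 f5 f6 f7 h10 h1D h20 h2D h30 h3D Ul Ur Eb Et hA2 hA3.
move=> gaps.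
apply: common_zero; [lra|lra|..].
- move=> P Q Pr Qr; have [g1 g2 g3] := gaps P Q Pr Qr.
  have k1 : (z.1 @[z --> (P, Q)] --> P)%classic by apply: cvg_fst.
  have k2 : (z.2 @[z --> (P, Q)] --> Q)%classic by apply: cvg_snd.
  have cc (k : R) : (k @[z --> (P, Q)] --> k)%classic by apply: cvg_cst.
  have w2 := weight_continuous h20 h2D g2; have w3 := weight_continuous h30 h3D g3.
  apply: cvgD; apply: cvgM => //; apply: cvgD; apply: cvgM => //;
    by apply: cvgD.
- move=> P Q Pr Qr; have [g1 g2 g3] := gaps P Q Pr Qr.
  have k1 : (z.1 @[z --> (P, Q)] --> P)%classic by apply: cvg_fst.
  have k2 : (z.2 @[z --> (P, Q)] --> Q)%classic by apply: cvg_snd.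
  have cc (k : R) : (k @[z --> (P, Q)] --> k)%classic by apply: cvg_cst.
  have w1 := weight_continuous h10 h1D g1.
  have w2 := weight_continuous h20 h2D g2; have w3 := weight_continuous h30 h3D g3.
  by apply: cvgD; [apply: cvgD|]; apply: cvgM => //; apply: cvgB; apply: cvgD.
- move=> P Q Q' Pr Q1 QQ Q0.
  have [_ g2 g3] := gaps P Q Pr ltac:(apply/andP; split; lra).
  have [_ _ g3'] := gaps P Q' Pr ltac:(apply/andP; split; lra).
  by apply: crossF_incr => //; lra.
- by move=> P Pr; rewrite Eb // Et.
- by move=> Q Qr; rewrite Ul // Ur.
Qed.

(** The two residuals are linear combinations of the coordinates of the sum,
    with determinant [c1.1.2 + P - Q] up to sign, which is nonzero here. *)
Lemma log_sum_zero (R : realType) (c1 c2 c3 : R * R * R) (P Q : R) :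
  c1.2 = 0 -> Q < c1.1.2 + P ->
  crossF c1 c2 c3 P Q = 0 -> diffF c1 c2 c3 P Q = 0 ->
  weight3 c1 P Q * (c1.1.2 + P) + weight3 c2 P Q * (c2.1.2 + P)
    + weight3 c3 P Q * (c3.1.2 + P) = 0 /\
  weight3 c1 P Q * (c1.2 + Q) + weight3 c2 P Q * (c2.2 + Q)
    + weight3 c3 P Q * (c3.2 + Q) = 0.
Proof.
move=> b10 uQ; rewrite /crossF /diffF b10.
move: (weight3 c1 P Q) (weight3 c2 P Q) (weight3 c3 P Q) => w1 w2 w3 E0 U0.
set F := w1 * (c1.1.2 + P) + _ + _; set G := w1 * _ + _ + _.
have FG : F = G by rewrite -[F]subr0 -U0 /F /G; ring.
have : (c1.1.2 + P - Q) * G = 0.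
  transitivity ((c1.1.2 + P) * G - Q * F); first by rewrite FG; ring.
  by rewrite -[RHS]E0 /F /G; ring.
move/eqP; rewrite mulf_eq0 gt_eqF /=; last by lra.
by move/eqP => G0; rewrite FG G0.
Qed.

Lemma log_gmean (R : realType) (c : R * R * R) (P Q : R) : hyperb c ->
  0 < gap c.1.2 c.2 P Q ->
  mxlog (gmean (smx c.1.1 c.1.2 c.2) (smx (hgt P Q) P Q))
  = smx 0 (weight3 c P Q * (c.1.2 + P)) (weight3 c P Q * (c.2 + Q)).
Proof.
case: c => [[a p] b] [/= a0 aD] g0.
have hD : hgt P Q ^+ 2 - (P ^+ 2 + Q ^+ 2) = 1 by rewrite sqr_hgt; ring.
have h0 := hgt_gt0 P Q.
rewrite (smx_gmean a0 aD h0 hD) /weight3 /weight /= -sqr_gap hdetE //.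
have s0 := hdet_gt0 P Q a0 aD; have sE := hdetE P Q aD; have gE := sqr_gap p b P Q.
move: (gap p b P Q) (hdet a p b P Q) g0 s0 sE gE => d s d0 s0 sE gE.
have r0 : 0 < Num.sqrt s by rewrite sqrtr_gt0.
have r2 : Num.sqrt s ^+ 2 = s by rewrite sqr_sqrtr // ltW.
move: (Num.sqrt s) r0 r2 => r r0 r2.
have rn : r != 0 by rewrite gt_eqF.
have dn : d != 0 by rewrite gt_eqF.
rewrite (@smx_log R _ _ _ (r^-1 * d)).
- have -> : r^-1 * (a + hgt P Q) + r^-1 * d = (a + hgt P Q + d) / r by ring.
  by move: (ln _) => l; congr smx; field; rewrite rn dn.
- by rewrite mulr_gt0 ?invr_gt0 // addr_gt0.
- by rewrite mulr_gt0 ?invr_gt0.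
- by rewrite !exprMn -mulrDr gE.
- by rewrite !exprMn -mulrBr sE exprVn r2 mulVf // gt_eqF.
Qed.

Lemma smx3_exp (R : realType) (d p q : R) : 0 < d -> d ^+ 2 = p ^+ 2 + q ^+ 2 ->
  mxexp (smx 0 p q) = smx (exp3 d p q).1.1 (exp3 d p q).1.2 (exp3 d p q).2.
Proof. exact: smx0_exp. Qed.

Lemma smx3_conj (R : realType) (b x : R * R * R) :
  smx b.1.1 b.1.2 b.2 *m smx x.1.1 x.1.2 x.2 *m smx b.1.1 b.1.2 b.2
  = smx (conj3 b x).1.1 (conj3 b x).1.2 (conj3 b x).2.
Proof. exact: smx_conj. Qed.

(** The logarithm inverts the exponential of a traceless symmetric matrix,
    hence recovers [Z1], [Z2] and [Z3] at the first solution. *)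
Lemma log_exp3 (R : realType) (d p q : R) : 0 < d -> d ^+ 2 = p ^+ 2 + q ^+ 2 ->
  mxlog (smx (exp3 d p q).1.1 (exp3 d p q).1.2 (exp3 d p q).2) = smx 0 p q.
Proof.
move=> d0 dE; have [h0 hD] := hyperb_exp d0 dE.
have sh0 : 0 < (expR d - expR (- d)) / 2.
  by rewrite divr_gt0 // subr_gt0 ltr_expR; lra.
have lnE : ln ((expR d + expR (- d)) / 2 + (expR d - expR (- d)) / 2) = d.
  rewrite -[RHS]expRK; congr ln.
  by move: (expR d) (expR (- d)) => x y; field.
have dn : d != 0 by rewrite gt_eqF.
have gE : ((expR d - expR (- d)) / 2) ^+ 2
    = (exp3 d p q).1.2 ^+ 2 + (exp3 d p q).2 ^+ 2.
  rewrite /exp3 /= !exprMn -mulrDr -dE.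
  by move: (expR d) (expR (- d)) => x y; field.
rewrite (smx_log h0 sh0 gE); last by rewrite gE.
rewrite /exp3 /= lnE.
move: ((expR d - expR (- d)) / 2) (gt_eqF sh0) => s /negbT sn.
by congr smx; field; rewrite dn sn.
Qed.

Lemma smx0_eq0 (R : realType) : smx (0 : R) 0 0 = 0.
Proof. by apply: mx2P; rewrite !mxE /= ?addr0 ?subr0. Qed.

Lemma log_gmean_sum_zero (R : realType) (c1 c2 c3 : R * R * R) (P Q : R) :
  hyperb c1 -> hyperb c2 -> hyperb c3 ->
  0 < gap c1.1.2 c1.2 P Q -> 0 < gap c2.1.2 c2.2 P Q ->
  0 < gap c3.1.2 c3.2 P Q ->
  c1.2 = 0 -> Q < c1.1.2 + P ->
  crossF c1 c2 c3 P Q = 0 -> diffF c1 c2 c3 P Q = 0 ->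
  mxlog (gmean (smx c1.1.1 c1.1.2 c1.2) (smx (hgt P Q) P Q))
  + mxlog (gmean (smx c2.1.1 c2.1.2 c2.2) (smx (hgt P Q) P Q))
  + mxlog (gmean (smx c3.1.1 c3.1.2 c3.2) (smx (hgt P Q) P Q)) = 0.
Proof.
move=> h1 h2 h3 g1 g2 g3 b10 uQ E0 U0.
rewrite [X in X + _ + _](log_gmean h1 g1) [X in _ + X + _](log_gmean h2 g2).
rewrite [X in _ + X](log_gmean h3 g3) !smx_add !addr0.
by have [-> ->] := log_sum_zero b10 uQ E0 U0; rewrite smx0_eq0.
Qed.

Lemma sum_ord3 (V : zmodType) (f : 'I_3 -> V) :
  \sum_(i < 3) f i
  = f (@Ordinal 3 0 isT) + f (@Ordinal 3 1 isT) + f (@Ordinal 3 2 isT).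
Proof.
rewrite !big_ord_recl big_ord0 addr0 addrA.
by congr (f _ + f _ + f _); apply: val_inj.
Qed.

Theorem mainTheorem1 (R : realType) :
  let S : 'M[R[i]]_2 := mx2 1 0 0 (-1) in
  let T : 'M[R[i]]_2 := mx2 0 1 1 0 in
  let c : R[i] := 19 / 10 in
  let X0 : 'M[R[i]]_2 := mxexp (3 *: S) in
  let Z1 := 3 *: S in
  let Z2 := c *: T in
  let Z3 := - Z1 - Z2 in
  let Z := fun i : 'I_3 => nth 0 [:: Z1; Z2; Z3] i in
  let B := fun i : 'I_3 => mxexp (Z i) in
  let A := fun i : 'I_3 => B i *m X0 *m B i in
  let Phi := fun X : 'M[R[i]]_2 =>
    3^-1 *: \sum_(i < 3) mxlog (gmean (A i) (invmx X)) in
  exists X Y : 'M[R[i]]_2,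
    [/\ posdefmx X, posdefmx Y, X <> Y, Phi X = 0 & Phi Y = 0].
Proof.
move=> S T c X0 Z1 Z2 Z3 Z B A Phi.
have SE : 3 *: S = smx 0 3 0 :> 'M[R[i]]_2.
  rewrite /S mx2_scale /smx.
  congr mx2; rewrite ?mulr1 ?mulr0 ?add0r ?sub0r ?mulrN1 //.
  - by rewrite rmorph_nat.
  - by rewrite rmorphN rmorph_nat.
have TE : c *: T = smx 0 0 (19 / 10) :> 'M[R[i]]_2.
  rewrite /T mx2_scale /smx addr0 subr0; congr mx2; rewrite ?mulr1 ?mulr0 //.
  - by rewrite /c fmorph_div !rmorph_nat.
  - by rewrite /c fmorph_div !rmorph_nat.
have ZE : Z3 = smx 0 (- 3) (- 19 / 10).
  rewrite /Z3 /Z1 /Z2 SE TE !smx_opp smx_add; congr smx; lra.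
have X0E : X0 = smx (Xpt R).1.1 (Xpt R).1.2 (Xpt R).2.
  by rewrite /X0 SE; apply: smx3_exp => //; ring.
have d3 : (3 : R) ^+ 2 = 3 ^+ 2 + 0 ^+ 2 by ring.
have dc : (19 / 10 : R) ^+ 2 = 0 ^+ 2 + (19 / 10) ^+ 2 by ring.
have dr : rho R ^+ 2 = (- 3) ^+ 2 + (- 19 / 10) ^+ 2 by rewrite sqr_rho; field.
have r0 := rho_gt0 R.
have c0 : 0 < (19 / 10 : R) by lra.
have B2E : mxexp Z2 = smx (Bpt2 R).1.1 (Bpt2 R).1.2 (Bpt2 R).2.
  by rewrite /Z2 TE; apply: smx3_exp.
have B3E : mxexp Z3 = smx (Bpt3 R).1.1 (Bpt3 R).1.2 (Bpt3 R).2.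
  by rewrite ZE; apply: smx3_exp.
have B1E : mxexp Z1 = smx (Xpt R).1.1 (Xpt R).1.2 (Xpt R).2 := X0E.
have PhiE X : Phi X = 3^-1 *: (mxlog (gmean (mxexp Z1 *m X0 *m mxexp Z1) (invmx X))
    + mxlog (gmean (mxexp Z2 *m X0 *m mxexp Z2) (invmx X))
    + mxlog (gmean (mxexp Z3 *m X0 *m mxexp Z3) (invmx X))).
  exact: (congr1 ( *:%R 3^-1) (sum_ord3 (fun i => mxlog (gmean (A i) (invmx X))))).
have [x0 xD] := hyperb_X R; have [b20 b2D] := hyperb_B2 R.
have [b30 b3D] := hyperb_B3 R.
have [P [Q [Pr Qr E0 U0]]] := second_zero R.
have hD : hgt P Q ^+ 2 - ((- P) ^+ 2 + (- Q) ^+ 2) = 1.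
  by rewrite sqr_hgt !sqrrN; ring.
exists X0, (smx (hgt P Q) (- P) (- Q)); split.
- by rewrite X0E; apply: smx_posdef.
- by apply: smx_posdef => //; apply: hgt_gt0.
- rewrite X0E => /matrixP/(_ 0 1); rewrite !mxE /= mulr0.
  by move=> /(congr1 (@complex.Re R)) /=; move/andP: Qr => [_]; lra.
- rewrite PhiE B1E B2E B3E X0E !smx_gmean_conj //.
  rewrite (log_exp3 _ d3) // (log_exp3 c0 dc) (log_exp3 r0 dr) !smx_add.
  by rewrite (_ : smx _ _ _ = 0) ?scaler0 // -smx0_eq0; congr smx; lra.
have [g1 g2 g3] := A_gap_gt0 Pr Qr.
have [[f1 f2 _ _] _] := A_bounds R.
have uQ : Q < (Apt1 R).1.2 + P.
  by move/andP: Pr => [P3 _]; move/andP: Qr => [_ Q0]; lra.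
have := log_gmean_sum_zero (hyperb_A1 R) (hyperb_A2 R) (hyperb_A3 R)
  g1 g2 g3 f2 uQ E0 U0.
rewrite PhiE smx_inv ?hgt_gt0 // !opprK B1E B2E B3E X0E.
rewrite (smx3_conj (Xpt R)) (smx3_conj (Bpt2 R)) (smx3_conj (Bpt3 R)).
by rewrite -/(Apt1 R) -/(Apt2 R) -/(Apt3 R) => ->; rewrite scaler0.
Qed.
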